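(* Let $p\in(0,1]$ and let $(A,\|\cdot\|)$ be a real $p$-Banach algebra with unit such that $\|a\|^{1/p}\le m\,r(a)$ for some positive constant $m$ and all $a\in A$. Then the map $J:A\to C(X(A),\mathbb{H})$, $a\mapsto J(a)$, is an isomorphism of real algebras onto its image (an injective homomorphism of real algebras) such that $$m^{-1}\|a\|^{1/p}\le\|J(a)\|_s\le\|a\|^{1/p}\quad\text{for all } a\in A,$$ where $\|\cdot\|_s$ is the supremum norm on $C(X(A),\mathbb{H})$. If $m=1$, then $\|a\|^{1/p}=\|J(a)\|_s$ for all $a\in A$.
   Context: Algebras are associative. For $p\in(0,1]$, a $p$-homogeneous norm on a real algebra $A$ is a map $\|\cdot\|:A\to[0,\infty)$ with $\|a+b\|\le\|a\|+\|b\|$, $\|\alpha a\|=|\alpha|^p\|a\|$ ($\alpha\in\mathbb{R}$), and $\|a\|=0$ only if $a=0$. A real $p$-Banach algebra is a real algebra with a complete submultiplicative ($\|ab\|\le\|a\|\|b\|$) $p$-homogeneous norm. For a real algebra $A$ with unit $e$ and $a\in A$, the spectrum is $Sp(a)=\{s+it\in\mathbb{C}: s,t\in\mathbb{R},\ (a-se)^2+t^2e\notin A^{-1}\}$, where $A^{-1}$ is the set of invertible elements of $A$, and the spectral radius is $r(a)=\sup\{|\alpha|:\alpha\in Sp(a)\}$; in a $p$-Banach algebra, $r(a)=\lim_{n\to\infty}\|a^n\|^{1/(pn)}$. $\mathbb{H}$ is the real algebra of quaternions with its usual norm $|\cdot|$. $X(A)$ is the set of all nonzero multiplicative real-linear maps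 $x:A\to\mathbb{H}$. For $a\in A$, $J(a):X(A)\to\mathbb{H}$ is defined by $J(a)x=x(a)$. $X(A)$ carries the weakest topology making all functions $J(a)$, $a\in A$, continuous. $C(X(A),\mathbb{H})$ is the real algebra of all continuous functions $X(A)\to\mathbb{H}$ with pointwise operations. *)

(* Defs.v *)
From HB Require Import structures.
From mathcomp Require Import all_boot all_order all_algebra.
From mathcomp Require Import complex.
From mathcomp Require Import all_classical all_reals all_analysis.
From mathcomp Require Import ring lra.

Set Implicit Arguments.
Unset Strict Implicit.
Unset Printing Implicit Defensive.

Import Order.TTheory GRing.Theory Num.Theory.
Import numFieldNormedType.Exports.

Local Open Scope classical_set_scope.
Local Open Scope ring_scope.

(* [Quat a b c d] is a + b i + c j + d k. *)
Record quat (R : Type) : Type := Quat { qre : R; qi : R; qj : R; qk : R }.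

Section quat_choice.
Variable R : Type.

Definition tuple_of_quat (q : quat R) : R * R * R * R :=
  (qre q, qi q, qj q, qk q).
Definition quat_of_tuple (t : R * R * R * R) : quat R :=
  let: (a, b, c, d) := t in Quat a b c d.

Lemma tuple_of_quatK : cancel tuple_of_quat quat_of_tuple.
Proof. by case. Qed.

End quat_choice.

HB.instance Definition _ (R : eqType) :=
  Equality.copy (quat R) (can_type (@tuple_of_quatK R)).
HB.instance Definition _ (R : choiceType) :=
  Choice.copy (quat R) (can_type (@tuple_of_quatK R)).

Section quat_algebra.
Variable R : realType.
Local Notation H := (quat R).

Definition addq (x y : H) : H :=
  Quat (qre x + qre y) (qi x + qi y) (qj x + qj y) (qk x + qk y).
Definition oppq (x : H) : H := Quat (- qre x) (- qi x) (- qj x) (- qk x).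
Definition scaleq (t : R) (x : H) : H :=
  Quat (t * qre x) (t * qi x) (t * qj x) (t * qk x).
Definition mulq (x y : H) : H :=
  let: Quat a b c d := x in
  let: Quat a' b' c' d' := y in
  Quat (a * a' - b * b' - c * c' - d * d')
       (a * b' + b * a' + c * d' - d * c')
       (a * c' - b * d' + c * a' + d * b')
       (a * d' + b * c' - c * b' + d * a').

Lemma addqA : associative addq.
Proof. by move=> x y z; rewrite /addq /= !addrA. Qed.
Lemma addqC : commutative addq.
Proof.
by move=> x y; congr Quat; exact: addrC.
Qed.
Lemma add0q : left_id (Quat 0 0 0 0) addq.
Proof. by case=> *; rewrite /addq /= !add0r. Qed.
Lemma addNq : left_inverse (Quat 0 0 0 0) oppq addq.
Proof. by case=> *; rewrite /addq /= !addNr. Qed.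

HB.instance Definition _ := GRing.isZmodule.Build H addqA addqC add0q addNq.

Lemma mulqA : associative mulq.
Proof. by case=> ? ? ? ? [? ? ? ?] [? ? ? ?]; congr Quat; ring. Qed.
Lemma mul1q : left_id (Quat 1 0 0 0) mulq.
Proof. by case=> *; congr Quat; ring. Qed.
Lemma mulq1 : right_id (Quat 1 0 0 0) mulq.
Proof. by case=> *; congr Quat; ring. Qed.
Lemma mulqDl : left_distributive mulq addq.
Proof. by case=> ? ? ? ? [? ? ? ?] [? ? ? ?]; congr Quat => /=; ring. Qed.
Lemma mulqDr : right_distributive mulq addq.
Proof. by case=> ? ? ? ? [? ? ? ?] [? ? ? ?]; congr Quat => /=; ring. Qed.
Lemma oneq_neq0 : Quat 1 0 0 0 != 0 :> H.
Proof. by apply/eqP => -[] /eqP; rewrite oner_eq0. Qed.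

HB.instance Definition _ :=
  GRing.Zmodule_isNzRing.Build H mulqA mul1q mulq1 mulqDl mulqDr oneq_neq0.

Lemma scaleqA (s t : R) (x : H) : scaleq s (scaleq t x) = scaleq (s * t) x.
Proof. by rewrite /scaleq /= !mulrA. Qed.
Lemma scale1q : left_id 1 scaleq.
Proof. by case=> *; rewrite /scaleq /= !mul1r. Qed.
Lemma scaleqDr : right_distributive scaleq +%R.
Proof. by move=> t x y; rewrite /scaleq /= !mulrDr. Qed.
Lemma scaleqDl (x : H) : {morph scaleq^~ x : s t / s + t}.
Proof. by move=> s t; rewrite /scaleq /= !mulrDl. Qed.

HB.instance Definition _ :=
  GRing.Zmodule_isLmodule.Build R H scaleqA scale1q scaleqDr scaleqDl.

Lemma scaleqAl (t : R) (x y : H) : t *: (x * y) = t *: x * y.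
Proof. by case: x y => ? ? ? ? [? ? ? ?]; congr Quat => /=; ring. Qed.

HB.instance Definition _ := GRing.Lmodule_isLalgebra.Build R H scaleqAl.

Lemma scaleqAr (t : R) (x y : H) : t *: (x * y) = x * (t *: y).
Proof. by case: x y => ? ? ? ? [? ? ? ?]; congr Quat => /=; ring. Qed.

HB.instance Definition _ := GRing.Lalgebra_isAlgebra.Build R H scaleqAr.

Definition sqnormq (x : H) : R := qre x ^+ 2 + qi x ^+ 2 + qj x ^+ 2 + qk x ^+ 2.
Definition normq (x : H) : R := Num.sqrt (sqnormq x).

Lemma sqnormq_ge0 x : 0 <= sqnormq x.
Proof. by rewrite !addr_ge0 ?sqr_ge0. Qed.

Lemma ler_normqD x y : normq (x + y) <= normq x + normq y.
Proof.
pose dot := qre x * qre y + qi x * qi y + qj x * qj y + qk x * qk y.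
have dotE : sqnormq (x + y) = sqnormq x + sqnormq y + dot *+ 2.
  by case: x y @dot => ? ? ? ? [? ? ? ?]; rewrite /sqnormq /=; ring.
have cs : dot <= normq x * normq y.
  rewrite -sqrtrM ?sqnormq_ge0// (le_trans (ler_norm _))// -sqrtr_sqr.
  rewrite ler_sqrt ?mulr_ge0 ?sqnormq_ge0// -subr_ge0.
  have -> : sqnormq x * sqnormq y - dot ^+ 2 =
      (qre x * qi y - qi x * qre y) ^+ 2 + (qre x * qj y - qj x * qre y) ^+ 2
    + (qre x * qk y - qk x * qre y) ^+ 2 + (qi x * qj y - qj x * qi y) ^+ 2
    + (qi x * qk y - qk x * qi y) ^+ 2 + (qj x * qk y - qk x * qj y) ^+ 2.
    by rewrite /sqnormq /dot; ring.
  by rewrite !addr_ge0 ?sqr_ge0.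
rewrite -(ler_pXn2r (n := 2)) ?nnegrE ?addr_ge0 ?sqrtr_ge0//.
rewrite sqrrD !sqr_sqrtr ?sqnormq_ge0// dotE -addrA [leRHS]addrAC -addrA.
by rewrite [leRHS]addrA addrA lerD2l lerMn2r.
Qed.

Lemma normqZ (t : R) (x : H) : normq (t *: x) = `|t| * normq x.
Proof.
rewrite /normq -sqrtr_sqr -sqrtrM ?sqr_ge0//; congr Num.sqrt.
by rewrite /sqnormq /=; ring.
Qed.

Lemma normq0_eq0 (x : H) : normq x = 0 -> x = 0.
Proof.
move/eqP; rewrite sqrtr_eq0 => N0.
have {}N0 : sqnormq x == 0 by rewrite eq_le N0 sqnormq_ge0.
move: N0; rewrite /sqnormq !paddr_eq0 ?addr_ge0 ?sqr_ge0// !sqrf_eq0.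
by case: x => a b c d /= /andP[/andP[/andP[/eqP-> /eqP->] /eqP->] /eqP->].
Qed.

HB.instance Definition _ :=
  Lmodule_isNormed.Build R H ler_normqD normqZ normq0_eq0.

Lemma normqE (x : H) : `|x| = normq x. Proof. by []. Qed.

Lemma normqM (x y : H) : `|x * y| = `|x| * `|y|.
Proof.
rewrite !normqE /normq -sqrtrM ?sqnormq_ge0//; congr Num.sqrt.
by case: x y => ? ? ? ? [? ? ? ?]; rewrite /sqnormq /=; ring.
Qed.

End quat_algebra.

Section continuous_quat.
Variables (R : realType) (X : topologicalType).
Local Notation H := (quat R).
Local Notation C := (continuousType X H).
Implicit Types f g h : C.

Lemma cfun_add_continuous f g : continuous (fun x => f x + g x).
Proof. by move=> x; apply: cvgD; exact: cts_fun. Qed.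
Lemma cfun_opp_continuous f : continuous (fun x => - f x).
Proof. by move=> x; apply: cvgN; exact: cts_fun. Qed.
Lemma cfun_scale_continuous (t : R) f : continuous (fun x => t *: f x).
Proof. by move=> x; apply: cvgZl_tmp; exact: cts_fun. Qed.
Lemma cfun_mul_continuous f g : continuous (fun x => f x * g x).
Proof.
move=> x; apply/subr_cvg0/norm_cvg0P.
pose b y := `|f y - f x| * `|g y| + `|f x| * `|g y - g x|.
apply: (@squeeze_cvgr _ _ _ _ (fun=> 0) b); last 2 first.
- exact: cvg_cst.
- rewrite (_ : 0 = 0 * `|g x| + `|f x| * 0); last by rewrite mul0r mulr0 addr0.
  apply: cvgD; apply: cvgM; [|by apply: cvg_norm; exact: cts_fun|exact: cvg_cst|];
    by apply/norm_cvg0P/subr_cvg0; exact: cts_fun.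
apply: nearW => y; rewrite normr_ge0/= /b -!normqM.
rewrite (_ : f y * g y - f x * g x = (f y - f x) * g y + f x * (g y - g x)).
  exact: ler_normD.
by rewrite mulrBl mulrBr addrA subrK.
Qed.

Definition cfun_zero : C := cst 0.
Definition cfun_one : C := cst 1.
Definition cfun_add f g : C := mkcts (@cfun_add_continuous f g).
Definition cfun_opp f : C := mkcts (@cfun_opp_continuous f).
Definition cfun_scale (t : R) f : C := mkcts (@cfun_scale_continuous t f).
Definition cfun_mul f g : C := mkcts (@cfun_mul_continuous f g).

Lemma cfun_addA : associative cfun_add.
Proof. by move=> f g h; apply/continuousEP => x; exact: addrA. Qed.
Lemma cfun_addC : commutative cfun_add.
Proof. by move=> f g; apply/continuousEP => x; exact: addrC. Qed.
Lemma cfun_add0 : left_id cfun_zero cfun_add.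
Proof. by move=> f; apply/continuousEP => x; exact: add0r. Qed.
Lemma cfun_addN : left_inverse cfun_zero cfun_opp cfun_add.
Proof. by move=> f; apply/continuousEP => x; exact: addNr. Qed.

HB.instance Definition _ :=
  GRing.isZmodule.Build C cfun_addA cfun_addC cfun_add0 cfun_addN.

Lemma cfun_mulA : associative cfun_mul.
Proof. by move=> f g h; apply/continuousEP => x; exact: mulrA. Qed.
Lemma cfun_mul1l : left_id cfun_one cfun_mul.
Proof. by move=> f; apply/continuousEP => x; exact: mul1r. Qed.
Lemma cfun_mul1r : right_id cfun_one cfun_mul.
Proof. by move=> f; apply/continuousEP => x; exact: mulr1. Qed.
Lemma cfun_mulDl : left_distributive cfun_mul cfun_add.
Proof. by move=> f g h; apply/continuousEP => x; exact: mulrDl. Qed.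
Lemma cfun_mulDr : right_distributive cfun_mul cfun_add.
Proof. by move=> f g h; apply/continuousEP => x; exact: mulrDr. Qed.

(* [X] may be empty, so this is a [pzRingType], and the algebra laws
   [cfun_scaleAl] and [cfun_scaleAr] below cannot be packed as an [algType]. *)
HB.instance Definition _ := GRing.Zmodule_isPzRing.Build C
  cfun_mulA cfun_mul1l cfun_mul1r cfun_mulDl cfun_mulDr.

Lemma cfun_scaleA (s t : R) f :
  cfun_scale s (cfun_scale t f) = cfun_scale (s * t) f.
Proof. by apply/continuousEP => x; exact: scalerA. Qed.
Lemma cfun_scale1 : left_id 1 cfun_scale.
Proof. by move=> f; apply/continuousEP => x; exact: scale1r. Qed.
Lemma cfun_scaleDr : right_distributive cfun_scale +%R.
Proof. by move=> t f g; apply/continuousEP => x; exact: scalerDr. Qed.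
Lemma cfun_scaleDl f : {morph cfun_scale^~ f : s t / s + t}.
Proof. by move=> s t; apply/continuousEP => x; exact: scalerDl. Qed.

HB.instance Definition _ := GRing.Zmodule_isLmodule.Build R C
  cfun_scaleA cfun_scale1 cfun_scaleDr cfun_scaleDl.

Lemma cfun_scaleAl (t : R) f g : t *: (f * g) = t *: f * g.
Proof. by apply/continuousEP => x; exact: scalerAl. Qed.
Lemma cfun_scaleAr (t : R) f g : t *: (f * g) = f * (t *: g).
Proof. by apply/continuousEP => x; exact: scalerAr. Qed.

(* Extended-real-valued, so that boundedness is not presupposed. *)
Definition supnorm f : \bar R := ereal_sup [set `|f x|%:E | x in [set: X]].

End continuous_quat.

Section p_banach.
Variables (R : realType) (A : algType R).

Record p_homogeneous_norm (p : R) (nrm : A -> R) : Prop := {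
  phn_ge0 : forall a, 0 <= nrm a;
  phn_triangle : forall a b, nrm (a + b) <= nrm a + nrm b;
  phn_homogeneous : forall (t : R) a, nrm (t *: a) = `|t| `^ p * nrm a;
  phn_definite : forall a, nrm a = 0 -> a = 0 }.

(* A [p]-homogeneous norm with [p < 1] is not a library norm, so completeness is
   spelled out for the metric [nrm (a - b)]. *)
Definition norm_complete (nrm : A -> R) : Prop :=
  forall u : nat -> A,
    (forall e, 0 < e -> exists N, forall i j, (N <= i)%N -> (N <= j)%N ->
       nrm (u i - u j) < e) ->
    exists l, nrm (u n - l) @[n --> \oo] --> (0 : R).

Record p_banach_norm (p : R) (nrm : A -> R) : Prop := {
  pbn_norm : p_homogeneous_norm p nrm;
  pbn_submult : forall a b, nrm (a * b) <= nrm a * nrm b;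
  pbn_complete : norm_complete nrm }.

Definition invertible (a : A) : Prop := exists b, a * b = 1 /\ b * a = 1.

Definition spectrum (a : A) : set R[i] :=
  [set z | ~ invertible ((a - (complex.Re z)%:A) ^+ 2
                         + (complex.Im z ^+ 2)%:A)].

(* The library norm of [z : R[i]] lives in [R[i]]; its real part is |z| in [R]. *)
Definition spectral_radius (a : A) : \bar R :=
  ereal_sup [set (complex.Re `|z|)%:E | z in spectrum a].

(* X(A) *)
Record qchar : Type := QChar {
  qchar_fun :> {linear A -> quat R};
  qcharM : {morph qchar_fun : a b / a * b >-> a * b};
  qchar_neq0 : exists a, qchar_fun a != 0 }.

HB.instance Definition _ := gen_eqMixin qchar.
HB.instance Definition _ := gen_choiceMixin qchar.

Definition qeval (a : A) (x : qchar) : quat R := x a.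

(* The coarsest topology on X(A) making every [qeval a] continuous. *)
HB.instance Definition _ := Topological.copy qchar
  (sup_topology (fun a => Topological.class (initial_topology (qeval a)))).

Lemma qeval_continuous (a : A) : continuous (qeval a).
Proof.
move=> x; pose Tc b := Topological.class (initial_topology (@qeval b)).
have /(cvg_sup Tc) /(_ a) xa :
    (nbhs x : set_system qchar) --> (x : sup_topology Tc) by exact: cvg_id.
by apply: cvg_trans (@initial_continuous _ _ (qeval a) x); exact: cvg_app.
Qed.

Definition J (a : A) : continuousType qchar (quat R) :=
  mkcts (@qeval_continuous a).

End p_banach.

(* Main.v *)
Require Import Defs.
From HB Require Import structures.
From mathcomp Require Import all_boot all_order all_algebra.
From mathcomp Require Import complex.
From mathcomp Require Import all_classical all_reals all_analysis.
From mathcomp Require Import ring lra.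

Set Implicit Arguments.
Unset Strict Implicit.
Unset Printing Implicit Defensive.

Import Order.TTheory GRing.Theory Num.Theory.
Import numFieldNormedType.Exports.
Local Open Scope classical_set_scope.
Local Open Scope ring_scope.

(** The upper bound [|x a| <= nrm a `^ p^-1] holds for every nonzero
multiplicative [x : A -> H] because such an [x] kills no invertible element and
[1 - c] is invertible as soon as [nrm c < 1].  The substance is the lower bound:
every [s + it] in the spectrum of [a] has to be of modulus [|x a|] for some
[x], and then [r(a) <= sup |x a|].  Three facts give this.

1. Every maximal left ideal [L] is two-sided.  Since [r] is invariant under
conjugation, the hypothesis makes all orbits [u * b * u^-1] bounded.  If
[L * b] were not inside [L], some [c] in [L] would satisfy [c * b = 1] modulo
[L]; on [A / L] the invertible element [u = 1 + t c] then acts as a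
transvection, and [u^n * b * u^-n - b] equals the scalar [n t] modulo [L],
which a bounded orbit and a Neumann series rule out
(maximal_left_ideal_two_sided).  As a consequence every noninvertible element,
in particular [(a - s)^2 + t^2], lies in a maximal ideal that is two-sided
(noninvertible_in_maximal).

2. In the division algebra [D = A / L] every element [b] is a root of a real
quadratic polynomial [(X - s)^2 + t^2] (gelfand_mazur).  The quotient norm is
only [p]-homogeneous, so it is first replaced, on a commutative subalgebra
containing [b], by the spectral seminorm, which is a genuine seminorm: in the
binomial expansion of [(x + y)^n] there are only [n + 1] terms, and a factor
[n + 1] does not affect the growth rate (spectral_seminormD).  For a seminorm
with [rho (x^2) = rho x ^ 2], the elementary argument of Rickart applies: with
[y = b^-1], the mean of [(1 - w r y)^-1] over the roots of unity [w] of order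
[n = 2^k] is [(1 - (r y)^n)^-1].  If no quadratic vanished on [b], these means
would be equicontinuous in [r]; they tend to [1] for [r < 1 / rho y] and
cannot do so at [r = 1 / rho y] (gelfand_mazur_quadratic).  To stay over the
reals, only real parts of resolvents are used, and the mean is taken by
repeated doubling of the angle.

3. A division algebra whose elements are all roots of such quadratics embeds in
the quaternions, by the theorem of Frobenius (frobenius_embedding).

Composing the projection [A -> A / L] with the embedding gives an [x] that kills
[(a - s)^2 + t^2], and a quaternion annihilated by [(X - s)^2 + t^2] has
norm [sqrt (s^2 + t^2)]. *)

(** * Real parts of resolvents and angle doubling *)

(** The model is the spectral radius of a commutative normed algebra; the square
law iterates to exponents [2 ^ k]. *)
Record pm_seminorm (R : realType) (K : algType R) (rho : K -> R) : Prop := {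
  pm_ge0 : forall x, 0 <= rho x;
  pm_triangle : forall x y, rho (x + y) <= rho x + rho y;
  pm_homogeneous : forall (t : R) x, rho (t *: x) = `|t| * rho x;
  pm_submult : forall x y, rho (x * y) <= rho x * rho y;
  pm_sqr : forall x, rho (x ^+ 2) = rho x ^+ 2;
  pm_one : rho 1 = 1 }.

Section Resolvent.
Variables (R : realType) (K : comUnitAlgType R).
Implicit Types (x y : K) (c r : R).

(** With [c = cos u], [re_resolvent y c] is the real part of
[(1 - e^(i u) y)^-1] and [resolvent_den y c] is the product of
[1 - e^(i u) y] with its conjugate; both make sense without complexifying
[K]. *)
Definition resolvent_den y c : K := 1 - (2 * c) *: y + y ^+ 2.
Definition re_resolvent y c : K := (1 - c *: y) / resolvent_den y c.

Lemma scaler_in_alg (t : R) x : t *: x = in_alg K t * x.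
Proof. by rewrite mulr_algl. Qed.

Lemma resolvent_den_sqr y c :
  resolvent_den (y ^+ 2) (2 * c ^+ 2 - 1)
  = resolvent_den y c * resolvent_den y (- c).
Proof.
rewrite /resolvent_den !scaler_in_alg !(rmorphB, rmorphM, rmorphXn).
rewrite !(rmorphN, rmorph1, rmorph_nat) /=.
move: (in_alg K c) => C; ring.
Qed.

(** Real part of [(1 - z)^-1 + (1 + z)^-1 = 2 (1 - z^2)^-1] at
[z = e^(i u) y]: squaring [z] squares [y] and doubles the angle, that is,
turns [c] into [2 c^2 - 1]. *)
Lemma re_resolvent_sqr y c :
  resolvent_den y c \is a GRing.unit -> resolvent_den y (- c) \is a GRing.unit ->
  re_resolvent (y ^+ 2) (2 * c ^+ 2 - 1)
  = 2^-1 *: (re_resolvent y c + re_resolvent y (- c)).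
Proof.
move=> u1 u2; rewrite /re_resolvent resolvent_den_sqr.
have u12 : resolvent_den y c * resolvent_den y (- c) \is a GRing.unit.
  by rewrite unitrM u1.
have pull (a b d e : K) : d \is a GRing.unit -> e \is a GRing.unit ->
    (a / d + b / e) * (d * e) = a * e + b * d.
  by move=> ud ue; rewrite mulrDl mulrA divrK// (mulrC d) mulrA divrK.
apply: (mulIr u12); rewrite divrK// -scalerAl pull//.
apply: (scalerI (a := 2)); first by rewrite pnatr_eq0.
rewrite scalerA divff ?pnatr_eq0// scale1r /resolvent_den.
rewrite !scaler_in_alg !(rmorphB, rmorphM, rmorphXn).
rewrite !(rmorphN, rmorph1, rmorph_nat) /=.
move: (in_alg K c) => C; ring.
Qed.

Lemma resolvent_den1 y : resolvent_den y 1 = (1 - y) ^+ 2.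
Proof. by rewrite /resolvent_den mulr1 scaler_nat; ring. Qed.

Lemma re_resolvent1 y : resolvent_den y 1 \is a GRing.unit ->
  re_resolvent y 1 = (1 - y)^-1.
Proof.
rewrite /re_resolvent scale1r resolvent_den1 unitrX_pos// => u.
by apply: (mulIr u); rewrite expr2 invrM// mulrA divrr// mul1r.
Qed.

End Resolvent.

Section SeminormTheory.
Variables (R : realType) (K : algType R) (rho : K -> R).
Hypothesis rhoP : pm_seminorm rho.
Implicit Types x y : K.

Lemma pm_opp x : rho (- x) = rho x.
Proof. by rewrite -scaleN1r (pm_homogeneous rhoP) normrN1 mul1r. Qed.

Lemma pm_sub x y : rho (x - y) <= rho x + rho y.
Proof. by rewrite -(pm_opp y); exact: (pm_triangle rhoP). Qed.

Lemma pm_dyadic x k : rho (x ^+ (2 ^ k)) = rho x ^+ (2 ^ k).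
Proof.
elim: k => [|k IH]; first by rewrite !expr1.
by rewrite expnSr !exprM (pm_sqr rhoP) IH.
Qed.

End SeminormTheory.

Section ResolventContinuity.
Variables (R : realType) (K : comUnitAlgType R) (rho : K -> R).
Hypothesis rhoP : pm_seminorm rho.
Implicit Types (x y z : K) (c r : R).

(** Uniform closeness in the angle is what survives the doubling of angles. *)
Definition resolvent_close (eps : R) y z := forall c, `|c| <= 1 ->
  [/\ resolvent_den y c \is a GRing.unit, resolvent_den z c \is a GRing.unit
    & rho (re_resolvent y c - re_resolvent z c) <= eps].

(** Each [c] in [[-1, 1]] is [2 d^2 - 1] for some [d] in [[-1, 1]], and
passing to squares replaces values at [c] by means of values at [d] and
[- d]; a mean does not increase a distance. *)
Lemma resolvent_close_sqr eps y z :
  resolvent_close eps y z -> resolvent_close eps (y ^+ 2) (z ^+ 2).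
Proof.
move=> close c /ler_normlP[cm1 c1].
have [d d2] : exists d, d ^+ 2 = (1 + c) / 2.
  by exists (Num.sqrt ((1 + c) / 2)); rewrite sqr_sqrtr//; lra.
have dle1 : `|d| <= 1.
  by rewrite -(ler_pXn2r (n := 2)) ?nnegrE// real_normK ?num_real// d2; lra.
have -> : c = 2 * d ^+ 2 - 1 by rewrite d2; field.
have [uy uz le] := close d dle1.
have [uy' uz' le'] : [/\ resolvent_den y (- d) \is a GRing.unit,
    resolvent_den z (- d) \is a GRing.unit
    & rho (re_resolvent y (- d) - re_resolvent z (- d)) <= eps].
  by apply: close; rewrite normrN.
split; first by rewrite resolvent_den_sqr unitrM uy.
  by rewrite resolvent_den_sqr unitrM uz.
rewrite !re_resolvent_sqr// -scalerBr (pm_homogeneous rhoP).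
rewrite ger0_norm ?invr_ge0// mulrC ler_pdivrMr//.
rewrite opprD addrACA (le_trans (pm_triangle rhoP _ _))//; lra.
Qed.

Lemma resolvent_close_dyadic eps y z k :
  resolvent_close eps y z -> resolvent_close eps (y ^+ (2 ^ k)) (z ^+ (2 ^ k)).
Proof.
move=> close; elim: k => [|k IH]; first by rewrite !expr1.
by rewrite expnSr !exprM; exact: resolvent_close_sqr.
Qed.

Section Local.
Variables (b : K) (r0 : R).
Hypothesis den_unit : forall r c, `|c| <= 1 ->
  resolvent_den (r *: b) c \is a GRing.unit.

(** A common bound for the variation of the numerator and of the denominator of
[re_resolvent (r *: b) c], written with [v = (c, r)], around [(c0, r0)]. *)
Definition resolvent_modulus (c0 : R) (v : R * R) : R :=
  let d := `|v.1 * v.2 - c0 * r0| in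
  2 * d * rho b + `|v.2 ^+ 2 - r0 ^+ 2| * rho b ^+ 2
  + `|c0 * r0 * v.2 ^+ 2 - v.1 * v.2 * r0 ^+ 2| * rho b ^+ 3.

Lemma resolvent_modulus_cvg0 c0 : resolvent_modulus c0 v @[v --> (c0, r0)] --> 0.
Proof.
have -> : 0 = resolvent_modulus c0 (c0, r0).
  by rewrite /resolvent_modulus /= !subrr normr0; ring.
have c1 : v.1 @[v --> (c0, r0)] --> (c0, r0).1 by exact: cvg_fst.
have c2 : v.2 @[v --> (c0, r0)] --> (c0, r0).2 by exact: cvg_snd.
have c22 : v.2 ^+ 2 @[v --> (c0, r0)] --> (c0, r0).2 ^+ 2.
  by rewrite expr2; under eq_fun do rewrite expr2; exact: cvgM.
have c12 : v.1 * v.2 @[v --> (c0, r0)] --> c0 * r0 by exact: cvgM.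
have cst (t : R) : (fun=> t) @ (c0, r0) --> t by exact: cvg_cst.
rewrite /resolvent_modulus /=; apply: cvgD; first apply: cvgD.
- apply: cvgM => //; apply: cvgM => //; apply: cvg_norm.
  exact: (cvgB c12 (cst (c0 * r0))).
- apply: cvgM => //; apply: cvg_norm; exact: cvgB.
- apply: cvgM => //; apply: cvg_norm; apply: cvgB; first exact: cvgM.
  exact: cvgM.
Qed.

Lemma pm_poly3 (t1 t2 t3 : R) :
  rho (t1 *: b + t2 *: b ^+ 2 + t3 *: b ^+ 3)
  <= `|t1| * rho b + `|t2| * rho b ^+ 2 + `|t3| * rho b ^+ 3.
Proof.
rewrite (le_trans (pm_triangle rhoP _ _))// lerD//.
  rewrite (le_trans (pm_triangle rhoP _ _))// !(pm_homogeneous rhoP).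
  by rewrite (pm_sqr rhoP).
rewrite (pm_homogeneous rhoP) ler_wpM2l// exprSr (le_trans (pm_submult rhoP _ _))//.
by rewrite (pm_sqr rhoP) -exprSr.
Qed.

Lemma resolvent_den_diff r c c0 :
  rho (resolvent_den (r0 *: b) c0 - resolvent_den (r *: b) c)
  <= resolvent_modulus c0 (c, r).
Proof.
have -> : resolvent_den (r0 *: b) c0 - resolvent_den (r *: b) c
  = (2 * (c * r - c0 * r0)) *: b + (- (r ^+ 2 - r0 ^+ 2)) *: b ^+ 2
    + 0 *: b ^+ 3.
  rewrite /resolvent_den scale0r !exprZn !scalerA !scaler_in_alg.
  rewrite !(rmorphB, rmorphM, rmorphXn, rmorphN, rmorph_nat) /=.
  move: (in_alg K c) (in_alg K c0) (in_alg K r) (in_alg K r0) => C C0 S S0; ring.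
rewrite (le_trans (pm_poly3 _ _ _))// /resolvent_modulus /= normr0 mul0r.
rewrite normrN normrM ger0_norm// lerD2l mulr_ge0 ?exprn_ge0 ?(pm_ge0 rhoP)//.
Qed.

Lemma resolvent_num_diff r c c0 :
  rho ((1 - c *: (r *: b)) * resolvent_den (r0 *: b) c0
       - (1 - c0 *: (r0 *: b)) * resolvent_den (r *: b) c)
  <= resolvent_modulus c0 (c, r).
Proof.
have -> : (1 - c *: (r *: b)) * resolvent_den (r0 *: b) c0
       - (1 - c0 *: (r0 *: b)) * resolvent_den (r *: b) c
  = (c * r - c0 * r0) *: b + (- (r ^+ 2 - r0 ^+ 2)) *: b ^+ 2
    + (c0 * r0 * r ^+ 2 - c * r * r0 ^+ 2) *: b ^+ 3.
  rewrite /resolvent_den !exprZn !scalerA !scaler_in_alg.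
  rewrite !(rmorphB, rmorphM, rmorphXn, rmorphN, rmorph_nat) /=.
  move: (in_alg K c) (in_alg K c0) (in_alg K r) (in_alg K r0) => C C0 S S0; ring.
rewrite (le_trans (pm_poly3 _ _ _))// /resolvent_modulus /= normrN !lerD2r.
by rewrite ler_wpM2r ?(pm_ge0 rhoP)// ler_peMl// ler1n.
Qed.

(** Once the denominator has moved by less than half of the inverse of
[rho u0], its inverse has at most doubled in [rho]; the difference of two
resolvents is then controlled by its numerator. *)
Lemma resolvent_near eps c0 : 0 < eps -> `|c0| <= 1 ->
  \forall c \near c0 & r \near r0, `|c| <= 1 ->
    rho (re_resolvent (r *: b) c - re_resolvent (r0 *: b) c0) <= eps.
Proof.
move=> eps0 c01; pose u0 := (resolvent_den (r0 *: b) c0)^-1.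
have small (t e : R) : 0 < e ->
    \forall v \near (c0, r0), t * resolvent_modulus c0 v <= e.
  move=> e0; have : t * resolvent_modulus c0 v @[v --> (c0, r0)] --> t * 0.
    by apply: cvgM (resolvent_modulus_cvg0 c0); exact: cvg_cst.
  by rewrite mulr0 => /cvgr_le; exact.
have half0 : 0 < 2^-1 :> R by rewrite invr_gt0.
have rho0 x : 0 <= rho x := pm_ge0 rhoP x.
apply: filterS2 (small (rho u0) _ half0) (small (2 * rho u0 ^+ 2) _ eps0).
move=> [c r] /= den_small num_small c1; set u := (resolvent_den (r *: b) c)^-1.
have du : resolvent_den (r *: b) c * u = 1 by rewrite divrr ?den_unit.
have du0 : resolvent_den (r0 *: b) c0 * u0 = 1 by rewrite divrr ?den_unit.
have u_le : rho u <= 2 * rho u0.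
  have uE : u = u0
      + u * u0 * (resolvent_den (r0 *: b) c0 - resolvent_den (r *: b) c).
    rewrite [RHS](_ : _ = u0 + u * (resolvent_den (r0 *: b) c0 * u0)
      - u0 * (resolvent_den (r *: b) c * u)); last by ring.
    by rewrite du du0 !mulr1 addrAC subrr add0r.
  have := pm_triangle rhoP u0
    (u * u0 * (resolvent_den (r0 *: b) c0 - resolvent_den (r *: b) c)).
  have : rho (u * u0 * (resolvent_den (r0 *: b) c0 - resolvent_den (r *: b) c))
      <= rho u * 2^-1; last by rewrite -uE; move: (rho (_ * _)) => P; lra.
  rewrite (le_trans (pm_submult rhoP _ _))//.
  rewrite (le_trans (ler_wpM2r _ (pm_submult rhoP _ _)))// -mulrA ler_wpM2l//.
  by rewrite (le_trans _ den_small)// ler_wpM2l// resolvent_den_diff.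
have -> : re_resolvent (r *: b) c - re_resolvent (r0 *: b) c0
  = u * u0 * ((1 - c *: (r *: b)) * resolvent_den (r0 *: b) c0
              - (1 - c0 *: (r0 *: b)) * resolvent_den (r *: b) c).
  rewrite /re_resolvent -/u -/u0 [RHS](_ : _ =
    (1 - c *: (r *: b)) * u * (resolvent_den (r0 *: b) c0 * u0)
    - (1 - c0 *: (r0 *: b)) * u0 * (resolvent_den (r *: b) c * u)); last by ring.
  by rewrite du du0 !mulr1.
rewrite (le_trans (pm_submult rhoP _ _))// (le_trans _ num_small)//.
rewrite ler_pM ?resolvent_num_diff//.
rewrite (le_trans (pm_submult rhoP _ _))// expr2 mulrA ler_wpM2r//.
Qed.

(** Compactness of [[-1, 1]] makes the local estimate uniform in the angle. *)
Lemma resolvent_close_near eps : 0 < eps ->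
  \forall r \near r0, resolvent_close eps (r *: b) (r0 *: b).
Proof.
move=> eps0; have eps20 : 0 < eps / 2 by rewrite divr_gt0.
have cptI : compact `[(-1) : R, 1]%classic := @segment_compact _ _ _.
have := (compact_near_coveringP _).1 cptI R (nbhs r0)
  (fun r c => `|c| <= 1 ->
    rho (re_resolvent (r *: b) c - re_resolvent (r0 *: b) c) <= eps) _.
have cover : forall c0, `[(-1) : R, 1]%classic c0 ->
    \forall c \near c0 & r \near r0, `|c| <= 1 ->
      rho (re_resolvent (r *: b) c - re_resolvent (r0 *: b) c) <= eps.
  move=> c0; rewrite /= in_itv /= -ler_norml => c01.
  have [[C S] /= [nC nS] CS] := resolvent_near eps20 c01.
  exists (C, S) => // -[c r] /= [Cc Sr] c1.
  (* The local estimate compares with the value at (c0, r0); it is used both at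
     (c, r) and at (c, r0). *)
  have cr := CS (c, r) (conj Cc Sr) c1.
  have cr0 := CS (c, r0) (conj Cc (nbhs_singleton nS)) c1.
  have -> : re_resolvent (r *: b) c - re_resolvent (r0 *: b) c
    = re_resolvent (r *: b) c - re_resolvent (r0 *: b) c0
      - (re_resolvent (r0 *: b) c - re_resolvent (r0 *: b) c0) by ring.
  rewrite (le_trans (pm_sub rhoP _ _))//; move: cr cr0 => /=.
  by move: (rho _) (rho _) => X Y; lra.
move=> /(_ (nbhs_filter r0) cover); apply: filterS => r close c c1.
split; [exact: den_unit|exact: den_unit|].
by apply: close => //; rewrite /= in_itv /= -ler_norml.
Qed.

End Local.
End ResolventContinuity.

Section GelfandMazur.
Variables (R : realType) (K : comUnitAlgType R) (rho : K -> R).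
Hypothesis rhoP : pm_seminorm rho.

(** Up to the unit [a^-2], the denominator is the quadratic of [a] at the
complex number [r e^(i u)], where [c = cos u]. *)
Lemma resolvent_den_unit (a : K) :
  (forall s t : R, (a - s%:A) ^+ 2 + (t ^+ 2)%:A \is a GRing.unit) ->
  forall r c : R, `|c| <= 1 -> resolvent_den (r *: a^-1) c \is a GRing.unit.
Proof.
move=> quad r c c1.
have ua : a \is a GRing.unit.
  by have := quad 0 0; rewrite scale0r subr0 expr0n scale0r addr0 unitrX_pos.
have c2 : 0 <= 1 - c ^+ 2.
  by rewrite subr_ge0 -real_normK ?num_real// expr_le1.
have -> : resolvent_den (r *: a^-1) c = a^-1 ^+ 2 *
    ((a - (c * r)%:A) ^+ 2 + ((r * Num.sqrt (1 - c ^+ 2)) ^+ 2)%:A).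
  rewrite exprMn sqr_sqrtr// /resolvent_den !scaler_in_alg.
  rewrite !(rmorphB, rmorphM, rmorphXn, rmorphN, rmorph_nat, rmorph1) /=.
  have aV : a * a^-1 = 1 by rewrite divrr.
  move: (c%:A : K) (r%:A : K) (a^-1) aV => C S b ab.
  transitivity ((a * b) ^+ 2 - 2 * C * S * b * (a * b) + (S * b) ^+ 2).
    by rewrite ab; ring.
  by ring.
by rewrite unitrM quad andbT unitrX_pos// unitrV.
Qed.

(** Put [b = a^-1] and [r0 = 1 / rho b].  For [r < r0] the element
[Y = (r b)^(2^k)] is small, so [g = (1 - Y)^-1] is close to [1]; by
equicontinuity so is [h = (1 - Z)^-1] with [Z = (r0 b)^(2^k)], uniformly
in [k].  But [rho Z = 1], and [Z = (h - 1) (1 - Z)] would be small. *)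
Theorem gelfand_mazur_quadratic (a : K) :
  ~ forall s t : R, (a - s%:A) ^+ 2 + (t ^+ 2)%:A \is a GRing.unit.
Proof.
move=> quad; have den_unit := resolvent_den_unit quad.
have rho0 x : 0 <= rho x := pm_ge0 rhoP x.
have ua : a \is a GRing.unit.
  by have := quad 0 0; rewrite scale0r subr0 expr0n scale0r addr0 unitrX_pos.
pose b := a^-1.
have b0 : 0 < rho b.
  rewrite lt_neqAle rho0 andbT eq_sym; apply/eqP => rb0.
  have := pm_submult rhoP a b; rewrite divrr// (pm_one rhoP) rb0 mulr0; lra.
pose r0 := (rho b)^-1.
have r00 : 0 < r0 by rewrite invr_gt0.
have eps0 : 0 < 8^-1 :> R by rewrite invr_gt0.
have := resolvent_close_near rhoP r0 den_unit eps0.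
have : \forall r \near r0^'-, 0 < r < r0.
  near=> r; apply/andP; split; near: r; last exact: nbhs_left_lt.
  exact: nbhs_left_gt.
move=> near1 near2.
have [r [/andP[r_gt0 r_lt] close]] :
    exists r, 0 < r < r0 /\ resolvent_close rho 8^-1 (r *: b) (r0 *: b).
  apply: (@filter_ex _ r0^'-); apply: filterI near1 _.
  exact: cvg_within near2.
have rho_r t : 0 < t -> rho (t *: b) = t * rho b.
  by move=> t0; rewrite (pm_homogeneous rhoP) gtr0_norm.
have rb1 : r * rho b < 1 by rewrite -ltr_pdivlMr// div1r.
have [k yk] : exists k, (r * rho b) ^+ (2 ^ k) <= 9^-1.
  have : (r * rho b) ^+ n @[n --> \oo] --> (0 : R).
    by apply: cvg_expr; rewrite ger0_norm// mulr_ge0// ltW.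
  have ninth0 : 0 < 9^-1 :> R by rewrite invr_gt0.
  move=> /cvgr_le /(_ _ ninth0)[N _ NP].
  exists N; apply: NP => /=; exact/ltnW/ltn_expl.
have := resolvent_close_dyadic rhoP k close.
set Y := (r *: b) ^+ _; set Z := (r0 *: b) ^+ _.
have rhoY : rho Y <= 9^-1 by rewrite (pm_dyadic rhoP) rho_r.
have rhoZ : rho Z = 1.
  by rewrite (pm_dyadic rhoP) rho_r// mulVf ?gt_eqF// expr1n.
move=> /(_ 1); rewrite normr1 lexx => -[//|uY uZ].
rewrite !re_resolvent1//.
move: uY uZ; rewrite !resolvent_den1 !unitrX_pos// => uY uZ.
set g := (1 - Y)^-1; set h := (1 - Z)^-1 => gh.
have gE : g = 1 + Y * g.
  by rewrite -[1](mulrV uY) -/g; ring.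
have hE : Z = (h - 1) * (1 - Z).
  by rewrite mulrBl mulVr// mul1r; ring.
have g1 := pm_triangle rhoP 1 (Y * g).
have g2 := pm_submult rhoP Y g.
have g3 : rho Y * rho g <= 9^-1 * rho g by rewrite ler_wpM2r.
have g4 : rho (Y * g) <= 8^-1.
  by move: g1; rewrite -gE (pm_one rhoP); lra.
(* [rho Y <= 1 / 9] gives [rho (g - 1) <= 1 / 8], and [h] is [1 / 8]-close
   to [g]. *)
have h1 : rho (h - 1) <= 4^-1.
  have -> : h - 1 = Y * g - (g - h) by rewrite {2}gE; ring.
  rewrite (le_trans (pm_sub rhoP _ _))//; lra.
have := pm_submult rhoP (h - 1) (1 - Z); rewrite -hE.
have := pm_sub rhoP 1 Z; rewrite (pm_one rhoP) rhoZ => z1.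
have : rho (h - 1) * rho (1 - Z) <= 4^-1 * 2 by rewrite ler_pM.
lra.
Unshelve. all: by end_near.
Qed.

End GelfandMazur.

(** * The spectral seminorm of a p-seminorm *)
Record p_seminorm (R : realType) (A : algType R) (p : R) (nu : A -> R) : Prop :=
  { psn_ge0 : forall a, 0 <= nu a;
    psn_triangle : forall a b, nu (a + b) <= nu a + nu b;
    psn_homogeneous : forall (t : R) a, nu (t *: a) = `|t| `^ p * nu a;
    psn_submult : forall a b, nu (a * b) <= nu a * nu b }.

Section PSeminormTheory.
Variables (R : realType) (A : algType R) (p : R) (nu : A -> R).
Hypotheses (p_gt0 : 0 < p) (nuP : p_seminorm p nu).
Implicit Types a b : A.

Lemma psn0 : nu 0 = 0.
Proof.
by rewrite -(scale0r 0) (psn_homogeneous nuP) normr0 powR0 ?mul0r ?gt_eqF.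
Qed.

Lemma psn_opp a : nu (- a) = nu a.
Proof.
by rewrite -scaleN1r (psn_homogeneous nuP) normrN1 powR1 mul1r.
Qed.

Lemma psn_sub a b : nu (a - b) <= nu a + nu b.
Proof. by rewrite -(psn_opp b); exact: (psn_triangle nuP). Qed.

Lemma psn_sum n (F : 'I_n -> A) : nu (\sum_(i < n) F i) <= \sum_(i < n) nu (F i).
Proof.
elim/big_ind2 : _ => [|a s b t le1 le2|//]; first by rewrite psn0.
by rewrite (le_trans (psn_triangle nuP _ _))// lerD.
Qed.

Lemma psn_exp a n : nu (a ^+ n) <= nu 1 * nu a ^+ n.
Proof.
elim: n => [|n IH]; first by rewrite expr0 mulr1.
rewrite !exprSr mulrA (le_trans (psn_submult nuP _ _))//.
by rewrite ler_wpM2r// (psn_ge0 nuP).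
Qed.

End PSeminormTheory.

Lemma one_powR (R : realType) (p : R) : 1 `^ p = 1 :> R.
Proof. by rewrite powR1. Qed.

(** Each of the [n + 1] powers [q^0, ..., q^n] is at least [q^n], and their sum is
at most [(1 - q)^-1]. *)
Lemma mul_exp_bounded (R : realType) (q : R) : 0 <= q -> q < 1 ->
  forall n, n.+1%:R * q ^+ n <= (1 - q)^-1.
Proof.
move=> q0 q1 n; rewrite -[leRHS]mul1r ler_pdivlMr ?subr_gt0//.
have geom : (1 - q) * \sum_(i < n.+1) q ^+ i <= 1.
  by rewrite -opprB mulNr -subrX1 opprB lerBlDr lerDl exprn_ge0.
rewrite (le_trans _ geom)// mulrC ler_wpM2l ?subr_ge0 ?(ltW q1)//.
rewrite mulr_natl -[X in _ *+ X]card_ord -sumr_const ler_sum// => i _.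
by rewrite ler_wiXn2l// ?ltW// -ltnS.
Qed.

Lemma ler_mul_gt (R : realType) (a b z : R) : 0 <= a -> 0 <= b ->
  (forall l m, a < l -> b < m -> z <= l * m) -> z <= a * b.
Proof.
move=> a0 b0 H; apply/ler_addgt0Pr => e e0.
pose d := Num.min 1 (e / (a + b + 1)).
have s0 : 0 < a + b + 1 by lra.
(* Since [d <= 1], the product [(a + d) (b + d)] is at most
   [a b + d (a + b + 1)]. *)
have d0 : 0 < d by rewrite lt_min ltr01 divr_gt0.
have d1 : d <= 1 by rewrite ge_min lexx.
have de : d * (a + b + 1) <= e by rewrite -ler_pdivlMr// ge_min lexx orbT.
have := H (a + d) (b + d); rewrite !ltrDl => /(_ d0 d0) zle.
rewrite (le_trans zle)//.
have dd : d * d <= d by rewrite ler_piMr// ltW.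
have -> : (a + d) * (b + d) = a * b + d * (a + b + 1) + (d * d - d) by ring.
lra.
Qed.

Section SpectralSeminorm.
Variables (R : realType) (K : comAlgType R) (p : R) (nu : K -> R).
Hypotheses (p_gt0 : 0 < p) (nuP : p_seminorm p nu) (nu1 : 0 < nu 1).
Implicit Types (x y : K) (l m t : R).

Definition power_bounded x := exists C, forall n, nu (x ^+ n) <= C.

Lemma power_bounded_ge0 x C : (forall n, nu (x ^+ n) <= C) -> 0 <= C.
Proof. by move=> /(_ 0%N); apply: le_trans; exact: (psn_ge0 nuP). Qed.

Lemma powR_norm_exp t n : `|t ^+ n| `^ p = (`|t| `^ p) ^+ n.
Proof.
elim: n => [|n IH]; first by rewrite !expr0 normr1 one_powR.
by rewrite !exprS normrM powRM ?normr_ge0// IH.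
Qed.

Lemma power_boundedZ x t : `|t| <= 1 -> power_bounded x ->
  power_bounded (t *: x).
Proof.
move=> t1 [C HC]; exists C => n.
rewrite exprZn (psn_homogeneous nuP) (le_trans _ (HC n))//.
rewrite ler_piMl ?(psn_ge0 nuP)// powR_norm_exp.
by rewrite exprn_ile1 ?powR_ge0// -[leRHS](one_powR p) ge0_ler_powR ?nnegrE// ltW.
Qed.

Lemma power_boundedM x y : power_bounded x -> power_bounded y ->
  power_bounded (x * y).
Proof.
move=> [C HC] [D HD]; exists (C * D) => n.
by rewrite exprMn (le_trans (psn_submult nuP _ _))// ler_pM ?(psn_ge0 nuP).
Qed.

Lemma power_bounded_sqr x : power_bounded (x ^+ 2) -> power_bounded x.
Proof.
move=> [C HC]; exists (C * (1 + nu x)) => n.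
have C0 := power_bounded_ge0 HC.
have x0 := psn_ge0 nuP x.
rewrite -(odd_double_half n) -mul2n exprD exprM.
case: (odd n); rewrite ?expr0 ?mul1r ?expr1.
  rewrite (le_trans (psn_submult nuP _ _))// mulrC.
  by rewrite ler_pM ?(psn_ge0 nuP)// lerDr.
by rewrite (le_trans (HC _))// ler_peMr// lerDl.
Qed.

Lemma binomial_term_le (s t : R) n (i : 'I_n.+1) : 0 <= s -> 0 <= t ->
  s ^+ (n - i) * t ^+ i *+ 'C(n, i) <= (s + t) ^+ n.
Proof.
move=> s0 t0; rewrite exprDn (bigD1 i)//= lerDl sumr_ge0// => j _.
by rewrite mulrn_wge0// mulr_ge0// exprn_ge0.
Qed.

(** This is where convexity appears although [nu] is only [p]-homogeneous: the
binomial expansion has [n + 1] terms, each with a coefficient at most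
[(s + t)^n], and [n + 1] is absorbed by the geometric decay of
[((s + t) `^ p)^n]. *)
Lemma power_bounded_convex x y (s t : R) : 0 <= s -> 0 <= t -> s + t < 1 ->
  power_bounded x -> power_bounded y -> power_bounded (s *: x + t *: y).
Proof.
move=> s0 t0 st1 [C HC] [D HD].
have C0 := power_bounded_ge0 HC; have D0 := power_bounded_ge0 HD.
have q0 : 0 <= (s + t) `^ p by exact: powR_ge0.
have q1 : (s + t) `^ p < 1.
  by rewrite -[ltRHS](one_powR p) gt0_ltr_powR ?nnegrE// addr_ge0.
exists ((1 - (s + t) `^ p)^-1 * (C * D)) => n.
apply: (@le_trans _ _ ((n.+1%:R * ((s + t) `^ p) ^+ n) * (C * D))); last first.
  by rewrite ler_wpM2r ?mulr_ge0// mul_exp_bounded.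
rewrite exprDn (le_trans (psn_sum p_gt0 nuP _))//.
rewrite -mulrA mulr_natl -[X in _ *+ X]card_ord -sumr_const.
apply: ler_sum => i _.
rewrite !exprZn -scalerAl -scalerAr scalerA -scaler_nat scalerA.
rewrite (psn_homogeneous nuP) ler_pM ?powR_ge0 ?(psn_ge0 nuP)//; last first.
  by rewrite (le_trans (psn_submult nuP _ _))// ler_pM ?(psn_ge0 nuP).
rewrite [leRHS](_ : _ = `|(s + t) ^+ n| `^ p); last first.
  by rewrite powR_norm_exp ger0_norm ?addr_ge0.
rewrite ge0_ler_powR ?nnegrE// ?(ltW p_gt0)//.
rewrite !ger0_norm ?exprn_ge0 ?addr_ge0// ?mulr_ge0 ?exprn_ge0//.
by rewrite mulr_natl binomial_term_le.
Qed.

(** The infimum of the [l > 0] for which [x / l] is power bounded is the spectral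
radius [lim (nu (x^n))^(1 / (p n))]; its algebraic laws then reduce to closure properties of power
bounded elements. *)
Definition spectral_set x := [set l : R | 0 < l /\ power_bounded (l^-1 *: x)].
Definition spectral_seminorm x := inf (spectral_set x).
Local Notation rho := spectral_seminorm.

Lemma spectral_set_lb x : has_lbound (spectral_set x).
Proof. by exists 0 => l [/ltW]. Qed.

Lemma spectral_set_neq0 x : spectral_set x !=set0.
Proof.
pose l := (nu x + 1) `^ p^-1.
have x1 : 0 < nu x + 1 by rewrite ltr_wpDl// (psn_ge0 nuP).
have l0 : 0 < l by exact: powR_gt0.
exists l; split => //; exists (nu 1) => n.
rewrite (le_trans (psn_exp nuP _ _))// ler_piMr ?(ltW nu1)//.
rewrite exprn_ile1 ?(psn_ge0 nuP)// (psn_homogeneous nuP).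
rewrite gtr0_norm ?invr_gt0// -powR_inv1 ?(ltW l0)// -powRrM mulN1r powRN.
rewrite /l -powRrM mulVf ?gt_eqF// powRr1 ?(ltW x1)//.
by rewrite mulrC ler_pdivrMr// mul1r lerDl.
Qed.

Lemma spectral_seminorm_ge0 x : 0 <= rho x.
Proof. by apply: lb_le_inf; [exact: spectral_set_neq0|move=> l [/ltW]]. Qed.

Lemma spectral_seminorm_le x l : 0 < l -> power_bounded (l^-1 *: x) -> rho x <= l.
Proof. by move=> l0 bx; apply: ge_inf => //; exact: spectral_set_lb. Qed.

Lemma spectral_seminorm_lt x l : rho x < l -> 0 < l /\ power_bounded (l^-1 *: x).
Proof.
move=> xl.
have [m [m0 bm] ml] := inf_lt (spectral_set_neq0 x) xl.
have l0 := lt_trans m0 ml; split => //.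
have -> : l^-1 *: x = (m / l) *: (m^-1 *: x).
  by rewrite scalerA mulrAC mulfV ?gt_eqF// mul1r.
apply: power_boundedZ bm.
by rewrite ger0_norm ?divr_ge0 ?(ltW m0) ?(ltW l0)// ler_pdivrMr// mul1r ltW.
Qed.

Lemma spectral_seminormM x y : rho (x * y) <= rho x * rho y.
Proof.
apply: ler_mul_gt => [||l m]; try exact: spectral_seminorm_ge0.
move=> /spectral_seminorm_lt[l0 xl] /spectral_seminorm_lt[m0 ym].
apply: spectral_seminorm_le; first exact: mulr_gt0.
rewrite invfM (_ : _ *: _ = (l^-1 *: x) * (m^-1 *: y)); last first.
  by rewrite -scalerAl -scalerAr scalerA.
exact: power_boundedM.
Qed.

Lemma spectral_seminormD x y : rho (x + y) <= rho x + rho y.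
Proof.
apply/ler_addgt0Pr => e e0; pose d := e / 3.
have d0 : 0 < d by rewrite divr_gt0.
have [l lE] : exists l, l = rho x + d by exists (rho x + d).
have [m mE] : exists m, m = rho y + d by exists (rho y + d).
have [l0 xl] : 0 < l /\ power_bounded (l^-1 *: x).
  by apply: spectral_seminorm_lt; rewrite lE ltrDl.
have [m0 ym] : 0 < m /\ power_bounded (m^-1 *: y).
  by apply: spectral_seminorm_lt; rewrite mE ltrDl.
pose k := rho x + rho y + e.
have lmk : l + m < k by rewrite lE mE /k /d; lra.
have k0 : 0 < k by lra.
apply: spectral_seminorm_le => //.
have -> : k^-1 *: (x + y) = (l / k) *: (l^-1 *: x) + (m / k) *: (m^-1 *: y).
  by rewrite !scalerA !(mulrAC _ k^-1) !mulfV ?gt_eqF// !mul1r scalerDr.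
apply: power_bounded_convex => //; rewrite ?divr_ge0 ?ltW//.
by rewrite -mulrDl ltr_pdivrMr// mul1r.
Qed.

Lemma spectral_seminorm0 : rho 0 = 0.
Proof.
apply/eqP; rewrite eq_le spectral_seminorm_ge0 andbT.
apply/ler_addgt0Pr => e e0; rewrite add0r; apply: spectral_seminorm_le => //.
rewrite scaler0; exists (nu 1) => -[|n]; first by rewrite expr0.
by rewrite expr0n (psn0 p_gt0 nuP) ltW.
Qed.

Lemma spectral_seminormZ_le t x : t != 0 -> rho (t *: x) <= `|t| * rho x.
Proof.
move=> t0; have nt0 : 0 < `|t| by rewrite normr_gt0.
rewrite mulrC -ler_pdivrMr//; apply/ler_addgt0Pr => e e0.
have : rho x < rho x + e by rewrite ltrDl.
move=> /spectral_seminorm_lt[l0 xl]; rewrite ler_pdivrMr//.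
apply: spectral_seminorm_le; first exact: mulr_gt0.
have -> : ((rho x + e) * `|t|)^-1 *: (t *: x)
    = (t / `|t|) *: ((rho x + e)^-1 *: x).
  by rewrite !scalerA invfM; congr (_ *: _); ring.
apply: power_boundedZ xl.
by rewrite normrM normfV normr_id mulfV// gt_eqF.
Qed.

Lemma spectral_seminormZ t x : rho (t *: x) = `|t| * rho x.
Proof.
have [->|t0] := eqVneq t 0.
  by rewrite scale0r normr0 mul0r spectral_seminorm0.
apply/eqP; rewrite eq_le spectral_seminormZ_le//=.
have tV0 : t^-1 != 0 by rewrite invr_eq0.
have := spectral_seminormZ_le (t *: x) tV0.
rewrite scalerA mulVf// scale1r normfV mulrC.
by rewrite ler_pdivlMr ?normr_gt0// mulrC.
Qed.

Lemma spectral_seminorm_sqr x : rho (x ^+ 2) = rho x ^+ 2.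
Proof.
apply/eqP; rewrite eq_le {1}expr2 spectral_seminormM/=.
apply/ler_addgt0Pr => e e0.
have : rho (x ^+ 2) < rho (x ^+ 2) + e by rewrite ltrDl.
move: (_ + e) => l /spectral_seminorm_lt[l0 xl].
rewrite -[leRHS]sqr_sqrtr ?(ltW l0)// ler_pXn2r ?nnegrE ?sqrtr_ge0//; last first.
  exact: spectral_seminorm_ge0.
apply: spectral_seminorm_le; first by rewrite sqrtr_gt0.
by apply: power_bounded_sqr; rewrite exprZn exprVn sqr_sqrtr// ltW.
Qed.

Lemma spectral_seminorm1 : rho 1 = 1.
Proof.
apply/eqP; rewrite eq_le; apply/andP; split.
  apply: spectral_seminorm_le => //; rewrite invr1 scale1r.
  by exists (nu 1) => n; rewrite expr1n.
rewrite leNgt; apply/negP.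
move=> /(inf_lt (spectral_set_neq0 1))[l [l0 [C HC]] l1].
pose q := l `^ p.
have q0 : 0 < q by exact: powR_gt0.
have q1 : q < 1.
  by rewrite -[ltRHS](one_powR p) gt0_ltr_powR ?nnegrE// ltW.
have nu1_le n : nu 1 <= C * q ^+ n.
  have := HC n; rewrite exprZn expr1n (psn_homogeneous nuP) powR_norm_exp.
  rewrite gtr0_norm ?invr_gt0// -[l^-1]powR_inv1 ?(ltW l0)//.
  by rewrite -powRrM mulN1r powRN exprVn mulrC ler_pdivrMr ?exprn_gt0.
have : C * q ^+ n @[n --> \oo] --> (C * 0).
  by apply: cvgMr; apply: cvg_expr; rewrite gtr0_norm.
rewrite mulr0 => /cvgr_lt /(_ _ nu1)[N _ /(_ N (leqnn N))].
by rewrite /= ltNge nu1_le.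
Qed.

Lemma spectral_seminormP : pm_seminorm rho.
Proof.
split; [exact: spectral_seminorm_ge0|exact: spectral_seminormD
  |exact: spectral_seminormZ|exact: spectral_seminormM
  |exact: spectral_seminorm_sqr|exact: spectral_seminorm1].
Qed.

End SpectralSeminorm.

(** * Bicommutants and the Gelfand-Mazur theorem *)
Section Bicommutant.
Variables (R : realType) (D : unitAlgType R) (b : D).

(** The bicommutant of a single element is a commutative subalgebra containing it
and closed under inverses, so that invertibility of polynomials in [b] means the
same in it and in [D]. *)
Definition bicommutant : {pred D} :=
  fun x => `[< forall y, GRing.comm b y -> GRing.comm y x >].

Lemma bicommutantP x :
  reflect (forall y, GRing.comm b y -> GRing.comm y x) (x \in bicommutant).
Proof. exact: asboolP. Qed.

Lemma bicommutant_divalg : divalg_closed bicommutant.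
Proof.
split; first by apply/bicommutantP => y _; exact: commr1.
  move=> t u v /bicommutantP cu /bicommutantP cv; apply/bicommutantP => y yb.
  apply: commrD; last exact: cv.
  by rewrite /GRing.comm -scalerAr -scalerAl cu.
move=> u v /bicommutantP cu /bicommutantP cv; apply/bicommutantP => y yb.
by apply: commrM; [exact: cu|apply: commrV; exact: cv].
Qed.

HB.instance Definition _ := GRing.isDivalgClosed.Build R D bicommutant
  bicommutant_divalg.

Record bicomm := BiComm { bicomm_val :> D; _ : bicomm_val \in bicommutant }.

HB.instance Definition _ := [isSub for bicomm_val].
HB.instance Definition _ := [Choice of bicomm by <:].
HB.instance Definition _ := [SubChoice_isSubUnitRing of bicomm by <:].
HB.instance Definition _ := [SubZmodule_isSubLmodule of bicomm by <:].
HB.instance Definition _ := [SubNzRing_SubLmodule_isSubLalgebra of bicomm by <:].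
HB.instance Definition _ := [SubLalgebra_isSubAlgebra of bicomm by <:].

Lemma bicomm_mulC : commutative (@GRing.mul bicomm).
Proof.
move=> x y; apply: val_inj; rewrite !rmorphM /=.
have /bicommutantP cx := valP x; have /bicommutantP cy := valP y.
by apply: cy; apply: cx.
Qed.

HB.instance Definition _ := GRing.PzRing_hasCommutativeMul.Build bicomm bicomm_mulC.
End Bicommutant.

Section GelfandMazurUnit.
Variables (R : realType) (D : unitAlgType R) (p : R) (nu : D -> R).
Hypotheses (p_gt0 : 0 < p) (nuP : p_seminorm p nu) (nu1 : 0 < nu 1).

(** The spectral seminorm of [nu] on the bicommutant of [b] reduces this to the
commutative seminormed case. *)
Theorem gelfand_mazur (b : D) :
  exists s t : R, (b - s%:A) ^+ 2 + (t ^+ 2)%:A \isn't a GRing.unit.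
Proof.
apply: contrapT => none.
have bb : b \in bicommutant b by apply/bicommutantP.
pose a : bicomm b := BiComm bb.
pose nuK (x : bicomm b) := nu (\val x).
have nuKP : p_seminorm p nuK.
  split => [x|x y|t x|x y]; rewrite /nuK; first exact: (psn_ge0 nuP).
  - by rewrite raddfD; exact: (psn_triangle nuP).
  - by rewrite linearZ; exact: (psn_homogeneous nuP).
  - by rewrite rmorphM; exact: (psn_submult nuP).
have nuK1 : 0 < nuK 1 by rewrite /nuK rmorph1.
have rhoP := spectral_seminormP p_gt0 nuKP nuK1.
apply: (gelfand_mazur_quadratic rhoP (a := a)) => s t.
have : \val ((a - s%:A) ^+ 2 + (t ^+ 2)%:A) \is a GRing.unit.
  apply: contrapT => /negP nu_st; apply: none; exists s, t.
  by move: nu_st; rewrite rmorphD rmorphXn rmorphB !linearZ rmorph1.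
by [].
Qed.

End GelfandMazurUnit.

(** * Quotient of an algebra by a two-sided ideal *)
Section QuotientAlgebra.
Variables (R : realType) (A : algType R).

Record two_sided_ideal (I : set A) : Prop := {
  ideal0 : I 0;
  idealB : forall a b, I a -> I b -> I (a - b);
  idealMl : forall a b, I b -> I (a * b);
  idealMr : forall a b, I a -> I (a * b);
  ideal_proper : ~ I 1 }.

Variables (I : set A) (idI : two_sided_ideal I).

Lemma idealN a : I a -> I (- a).
Proof.
by move=> Ia; rewrite -sub0r; apply: (idealB idI) => //; exact: ideal0.
Qed.

Lemma idealD a b : I a -> I b -> I (a + b).
Proof.
by move=> Ia Ib; rewrite -[b]opprK; apply: (idealB idI) => //; exact: idealN.
Qed.

Lemma idealZ (t : R) a : I a -> I (t *: a).
Proof. by move=> Ia; rewrite -mulr_algl; exact: idealMl. Qed.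

Definition ideal_rel : rel A := fun a b => `[< I (a - b) >].

Lemma ideal_rel_equiv : equiv_class_of ideal_rel.
Proof.
split.
- by move=> a; apply/asboolP; rewrite subrr; exact: ideal0.
- by move=> a b; apply/asboolP/asboolP => /idealN; rewrite opprB.
- move=> b a c /asboolP Iab /asboolP Ibc; apply/asboolP.
  by rewrite -(subrKA b); exact: idealD.
Qed.

Definition ideal_equiv := EquivRelPack ideal_rel_equiv.
(** [idI] occurs in the type itself, so that the algebraic structures, which depend
on it, can be inferred. *)
Definition quot := {eq_quot ideal_equiv}%qT.
HB.instance Definition _ := Choice.on quot.
HB.instance Definition _ := EqQuotient.on quot.

Definition qproj (a : A) : quot := (\pi_quot a)%qT.

Lemma proj_eq a b : qproj a = qproj b <-> I (a - b).
Proof.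
split => [/eqquotP/asboolP//|Iab]; by apply/eqquotP/asboolP.
Qed.

Lemma projP (x : quot) : exists a, x = qproj a.
Proof. by exists (repr x); rewrite /qproj reprK. Qed.

Lemma repr_proj a : I (repr (qproj a) - a).
Proof. by apply/proj_eq; rewrite /qproj reprK. Qed.

Definition qadd (x y : quot) := qproj (repr x + repr y).
Definition qopp (x : quot) := qproj (- repr x).
Definition qmul (x y : quot) := qproj (repr x * repr y).
Definition qscale (t : R) (x : quot) := qproj (t *: repr x).

Lemma proj_add a b : qadd (qproj a) (qproj b) = qproj (a + b).
Proof.
apply/proj_eq; rewrite opprD addrACA; apply: idealD; exact: repr_proj.
Qed.

Lemma proj_opp a : qopp (qproj a) = qproj (- a).
Proof.
by apply/proj_eq; rewrite -opprD; apply: idealN; exact: repr_proj.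
Qed.

Lemma proj_mul a b : qmul (qproj a) (qproj b) = qproj (a * b).
Proof.
apply/proj_eq.
have -> : repr (qproj a) * repr (qproj b) - a * b =
    (repr (qproj a) - a) * repr (qproj b) + a * (repr (qproj b) - b).
  by rewrite mulrBl mulrBr addrA subrK.
apply: idealD; first by apply: (idealMr idI); exact: repr_proj.
by apply: (idealMl idI); exact: repr_proj.
Qed.

Lemma proj_scale t a : qscale t (qproj a) = qproj (t *: a).
Proof.
by apply/proj_eq; rewrite -scalerBr; apply: idealZ; exact: repr_proj.
Qed.

Ltac lift_proj := repeat (let x := fresh in move=> x; have [? ->] := projP x);
  rewrite ?(proj_add, proj_opp, proj_mul, proj_scale).

Lemma qaddA : associative qadd.
Proof. by lift_proj; rewrite addrA. Qed.
Lemma qaddC : commutative qadd.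
Proof. by lift_proj; rewrite addrC. Qed.
Lemma qadd0 : left_id (qproj 0) qadd.
Proof. by lift_proj; rewrite add0r. Qed.
Lemma qaddN : left_inverse (qproj 0) qopp qadd.
Proof. by lift_proj; rewrite addNr. Qed.
HB.instance Definition _ := GRing.isZmodule.Build quot qaddA qaddC qadd0 qaddN.

Lemma qmulA : associative qmul.
Proof. by lift_proj; rewrite mulrA. Qed.
Lemma qmul1l : left_id (qproj 1) qmul.
Proof. by lift_proj; rewrite mul1r. Qed.
Lemma qmul1r : right_id (qproj 1) qmul.
Proof. by lift_proj; rewrite mulr1. Qed.
Lemma qmulDl : left_distributive qmul qadd.
Proof. by lift_proj; rewrite mulrDl. Qed.
Lemma qmulDr : right_distributive qmul qadd.
Proof. by lift_proj; rewrite mulrDr. Qed.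
Lemma qone_neq0 : qproj 1 != qproj 0.
Proof. by apply/eqP => /proj_eq; rewrite subr0; exact: ideal_proper. Qed.
HB.instance Definition _ := GRing.Zmodule_isNzRing.Build quot
  qmulA qmul1l qmul1r qmulDl qmulDr qone_neq0.

Lemma qscaleA (s t : R) (x : quot) : qscale s (qscale t x) = qscale (s * t) x.
Proof. by move: x; lift_proj; rewrite scalerA. Qed.
Lemma qscale1 : left_id 1 qscale.
Proof. by lift_proj; rewrite scale1r. Qed.
Lemma qscaleDr : right_distributive qscale +%R.
Proof.
move=> t x y; have [a ->] := projP x; have [b ->] := projP y.
rewrite -[LHS]/(qscale _ (qadd _ _)) -[RHS]/(qadd (qscale _ _) (qscale _ _)).
by rewrite proj_add !proj_scale proj_add scalerDr.
Qed.
Lemma qscaleDl (x : quot) : {morph qscale^~ x : s t / s + t}.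
Proof.
move=> s t; have [a ->] := projP x.
rewrite -[RHS]/(qadd (qscale _ _) (qscale _ _)).
by rewrite !proj_scale proj_add scalerDl.
Qed.
HB.instance Definition _ := GRing.Zmodule_isLmodule.Build R quot
  qscaleA qscale1 qscaleDr qscaleDl.

Lemma qscaleAl (t : R) (x y : quot) : t *: (x * y) = t *: x * y.
Proof.
have [a ->] := projP x; have [b ->] := projP y.
rewrite -[LHS]/(qscale _ (qmul _ _)) -[RHS]/(qmul (qscale _ _) _).
by rewrite !(proj_mul, proj_scale) scalerAl.
Qed.
HB.instance Definition _ := GRing.Lmodule_isLalgebra.Build R quot qscaleAl.

Lemma qscaleAr (t : R) (x y : quot) : t *: (x * y) = x * (t *: y).
Proof.
have [a ->] := projP x; have [b ->] := projP y.
rewrite -[LHS]/(qscale _ (qmul _ _)) -[RHS]/(qmul _ (qscale _ _)).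
by rewrite !(proj_mul, proj_scale) scalerAr.
Qed.
HB.instance Definition _ := GRing.Lalgebra_isAlgebra.Build R quot qscaleAr.

Lemma projD a b : qproj (a + b) = qproj a + qproj b.
Proof. by rewrite -proj_add. Qed.
Lemma projB a b : qproj (a - b) = qproj a - qproj b.
Proof. by rewrite projD -proj_opp. Qed.
Lemma projM a b : qproj (a * b) = qproj a * qproj b.
Proof. by rewrite -proj_mul. Qed.
Lemma projZ t a : qproj (t *: a) = t *: qproj a.
Proof. by rewrite -proj_scale. Qed.

HB.instance Definition _ := GRing.isZmodMorphism.Build A quot qproj projB.
HB.instance Definition _ := GRing.isMonoidMorphism.Build A quot qproj
  (erefl, projM).
HB.instance Definition _ := GRing.isScalable.Build R A quot *:%R qproj projZ.

Definition qinvertible : pred quot :=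
  fun x => `[< exists y, y * x = 1 /\ x * y = 1 >].
Definition qinv (x : quot) : quot := xget x [set y | y * x = 1 /\ x * y = 1].

Lemma qinvP x : qinvertible x -> qinv x * x = 1 /\ x * qinv x = 1.
Proof.
move=> /asboolP[y xy].
exact: (@xgetI _ x [set y | y * x = 1 /\ x * y = 1] _ xy).
Qed.

Lemma qmulVr : {in qinvertible, left_inverse 1 qinv *%R}.
Proof. by move=> x /qinvP[]. Qed.
Lemma qmulrV : {in qinvertible, right_inverse 1 qinv *%R}.
Proof. by move=> x /qinvP[]. Qed.
Lemma qinvertibleP (x y : quot) : y * x = 1 /\ x * y = 1 -> qinvertible x.
Proof. by move=> xy; apply/asboolP; exists y. Qed.
Lemma qinv_out : {in [predC qinvertible], qinv =1 id}.
Proof.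
move=> x; rewrite inE /= => /asboolP nx; apply: xgetPN => y xy.
by apply: nx; exists y.
Qed.
HB.instance Definition _ := GRing.NzRing_hasMulInverse.Build quot
  qmulVr qmulrV qinvertibleP qinv_out.

End QuotientAlgebra.

(** * The theorem of Frobenius *)
Section QuaternionCoordinates.
Variables (R : realType) (D : algType R).
Implicit Types (q r : quat R) (x y : D).

Definition quat_eval (i j k : D) q : D :=
  (qre q)%:A + qi q *: i + qj q *: j + qk q *: k.

Lemma quat_eval_linear i j k : linear (quat_eval i j k).
Proof.
move=> t q r; rewrite /quat_eval /= !scalerDl !scalerDr !scalerA.
rewrite [RHS]addrACA; congr (_ + _); rewrite [RHS]addrACA; congr (_ + _).
by rewrite addrACA.
Qed.

Lemma quat_evalZ i j k t q :
  quat_eval i j k (t *: q) = t *: quat_eval i j k q.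
Proof. by rewrite /quat_eval /= !scalerDr !scalerA. Qed.

Lemma quat_linear_ext (f h : quat R -> D) : linear f -> linear h ->
  f (Quat 1 0 0 0) = h (Quat 1 0 0 0) -> f (Quat 0 1 0 0) = h (Quat 0 1 0 0) ->
  f (Quat 0 0 1 0) = h (Quat 0 0 1 0) -> f (Quat 0 0 0 1) = h (Quat 0 0 0 1) ->
  f =1 h.
Proof.
move=> lf lh f1 fi fj fk q.
have f0 : f 0 = 0 by have := lf (-1) 0 0; rewrite scaler0 addr0 scaleN1r addNr.
have h0 : h 0 = 0 by have := lh (-1) 0 0; rewrite scaler0 addr0 scaleN1r addNr.
have -> : q = qre q *: Quat 1 0 0 0 + (qi q *: Quat 0 1 0 0
    + (qj q *: Quat 0 0 1 0 + (qk q *: Quat 0 0 0 1 + 0))).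
  by case: q => a b c d; congr Quat => /=; ring.
by rewrite !lf !lh f1 fi fj fk f0 h0.
Qed.

(** Both sides are bilinear in [q] and [r], so the multiplication table of
the basis decides. *)
Lemma quat_evalM i j : i * i = -1 -> j * j = -1 -> j * i = - (i * j) ->
  forall q r, quat_eval i j (i * j) (q * r)
    = quat_eval i j (i * j) q * quat_eval i j (i * j) r.
Proof.
move=> ii jj ji.
have lg := quat_eval_linear i j (i * j); set g := quat_eval _ _ _ in lg *.
have mulA q : linear (fun r => g q * g r).
  by move=> t r s; rewrite lg mulrDr scalerAr.
have mulB q : linear (fun r => g (q * r)).
  by move=> t r s; rewrite mulrDr -scalerAr lg.
have mulC r : linear (fun q => g q * g r).
  by move=> t q s; rewrite lg mulrDl scalerAl.
have mulD r : linear (fun q => g (q * r)).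
  by move=> t q s; rewrite mulrDl -scalerAl lg.
have iij : i * (i * j) = - j by rewrite mulrA ii mulN1r.
have ijj : i * j * j = - i by rewrite -mulrA jj mulrN1.
have iji : i * j * i = j by rewrite -mulrA ji mulrN iij opprK.
have jij : j * (i * j) = i by rewrite mulrA ji mulNr ijj opprK.
have ijij : i * j * (i * j) = -1 by rewrite mulrA iji jj.
move=> q r; move: q; apply: quat_linear_ext => //;
  move: r; apply: quat_linear_ext => //;
  rewrite /g /quat_eval /=
    ?(mul0r, mulr0, mul1r, mulr1, subr0, sub0r, addr0, add0r, oppr0,
      scale0r, scale1r, scaleN1r, scaler0);
  by rewrite ?(ii, jj, ji, iij, ijj, iji, jij, ijij).
Qed.

Definition quat_conj q := Quat (qre q) (- qi q) (- qj q) (- qk q).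

Lemma mulq_conj q : q * quat_conj q = Quat (sqnormq q) 0 0 0.
Proof. by case: q => a b c d; congr Quat; rewrite /sqnormq /=; ring. Qed.

Lemma quat_eval_real i j k (t : R) : quat_eval i j k (Quat t 0 0 0) = t%:A.
Proof. by rewrite /quat_eval /= !scale0r !addr0. Qed.

(** [S] is the part of the quaternions that coordinates are taken from: the reals,
the complex numbers or everything.  Injectivity on [S] comes for free, as
[q * quat_conj q] is the scalar [sqnormq q]. *)
Lemma quat_embedding i j k (S : set (quat R)) (g := quat_eval i j k) :
  S 1 -> (forall t q r, S q -> S r -> S (t *: q + r)) ->
  (forall q, S q -> S (quat_conj q)) ->
  (forall q r, S q -> S r -> S (q * r) /\ g (q * r) = g q * g r) ->
  (forall x, exists2 q, S q & g q = x) ->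
  exists f : D -> quat R, [/\ linear f, {morph f : x y / x * y} & f 1 = 1].
Proof.
move=> S1 Slin Sconj gM gsurj.
have lg : linear g by exact: quat_eval_linear.
have g1 : g 1 = 1 by rewrite /g quat_eval_real scale1r.
have ginj q : S q -> g q = 0 -> q = 0.
  move=> Sq q0; have [_] := gM _ _ Sq (Sconj _ Sq).
  rewrite mulq_conj /g quat_eval_real -/g q0 mul0r => /eqP.
  rewrite scaler_eq0 oner_eq0 orbF => /eqP N0.
  by apply: normq0_eq0; rewrite /Defs.normq N0 sqrtr0.
have uniq q r : S q -> S r -> g q = g r -> q = r.
  move=> Sq Sr gqr; apply/eqP; rewrite -subr_eq0 addrC -scaleN1r; apply/eqP.
  by apply: ginj; [exact: Slin|rewrite lg gqr scaleN1r addNr].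
pose f x := xget 0 [set q | S q /\ g q = x].
have fP x : S (f x) /\ g (f x) = x.
  have [q Sq gq] := gsurj x.
  exact: (@xgetI _ 0 [set q | S q /\ g q = x] q (conj Sq gq)).
exists f; split => [t x y|x y|].
- have [Sx gx] := fP x; have [Sy gy] := fP y; have [Sxy gxy] := fP (t *: x + y).
  by apply: uniq => //; [exact: Slin|rewrite gxy lg gx gy].
- have [Sx gx] := fP x; have [Sy gy] := fP y; have [Sxy gxy] := fP (x * y).
  have [SM gMxy] := gM _ _ Sx Sy.
  by apply: uniq => //; rewrite gxy gMxy gx gy.
- by have [Sf1 gf1] := fP 1; apply: uniq => //; rewrite gf1 g1.
Qed.

End QuaternionCoordinates.

Section Frobenius.
Variables (R : realType) (D : unitAlgType R).
Hypothesis divD : forall x : D, x != 0 -> x \is a GRing.unit.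
Hypothesis quadD : forall x : D, exists s t : R,
  (x - s%:A) ^+ 2 + (t ^+ 2)%:A = 0.
Implicit Types x y z : D.

Lemma division_mul_eq0 x y : x * y = 0 -> x = 0 \/ y = 0.
Proof.
move=> xy; have [->|x0] := eqVneq x 0; [by left|right].
by apply: (mulrI (divD x0)); rewrite xy mulr0.
Qed.

Lemma scalar_comm x (t : R) : x * t%:A = t%:A * x.
Proof. by rewrite mulr_algl mulr_algr. Qed.

(** Commuting factors: [(x - t y) (x + t y) = x^2 - t^2 y^2 = 0]. *)
Lemma comm_root x y (t : R) : x * y = y * x -> x * x = (t ^+ 2) *: (y * y) ->
  x = t *: y \/ x = - (t *: y).
Proof.
move=> xy xx.
have : (x - t *: y) * (x + t *: y) = 0.
  rewrite mulrDr !mulrBl xx -!scalerAl -!scalerAr xy scalerA expr2 subrKA.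
  by rewrite subrr.
by move=> /division_mul_eq0[/subr0_eq|/addr0_eq <-]; [left|right; rewrite opprK].
Qed.

Lemma imaginary_part x : exists s t : R,
  (x - s%:A) * (x - s%:A) = - (t ^+ 2)%:A.
Proof.
have [s [t]] := quadD x; rewrite expr2 => /eqP; rewrite addr_eq0 => /eqP ?.
by exists s, t.
Qed.

(** The centralizer of [i] is a copy of the complex numbers: the imaginary part
of [x] commutes with [i] and has the square of a real multiple of [i]. *)
Lemma commutant_imaginary i x : i * i = -1 -> x * i = i * x ->
  exists a c : R, x = a%:A + c *: i.
Proof.
move=> ii xi; have [s [t xx]] := imaginary_part x.
have yi : (x - s%:A) * i = i * (x - s%:A).
  by rewrite mulrBl mulrBr xi scalar_comm.
have [|xs|xs] := @comm_root _ _ t yi; first by rewrite xx ii scalerN.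
- by exists s, t; rewrite -xs addrC subrK.
- by exists s, (- t); rewrite scaleNr -xs addrC subrK.
Qed.

Lemma exists_imaginary : (exists x, forall s : R, x != s%:A) ->
  exists i : D, i * i = -1.
Proof.
move=> [x xR]; have [s [t xx]] := imaginary_part x.
have t0 : t != 0.
  apply: contra_neq (xR s) => t0; move: xx; rewrite t0 expr0n scale0r oppr0.
  by move=> /division_mul_eq0[] /subr0_eq.
exists (t^-1 *: (x - s%:A)); rewrite -scalerAl -scalerAr scalerA xx scalerN.
by rewrite scalerA -invfM -expr2 mulVf ?scale1r// expf_neq0.
Qed.

Lemma double_eq0 x : x = - x -> x = 0.
Proof.
move/eqP; rewrite -subr_eq0 opprK -mulr2n -scaler_nat scaler_eq0 pnatr_eq0.
by move/eqP.
Qed.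

(** Twice the anticommuting part of [x] is [w = x + i x i].  Its square commutes
with [i], hence is [a + c i]; it also commutes with [w], which forces
[c = 0]; and [a >= 0] would make [w] real. *)
Lemma exists_anticommuting i : i * i = -1 -> (exists x, x * i <> i * x) ->
  exists j, j * j = -1 /\ j * i = - (i * j).
Proof.
move=> ii [x xi]; pose w := x + i * x * i.
have iw : i * w = i * x - x * i.
  by rewrite mulrDr !mulrA ii mulN1r mulNr.
have wi : w * i = - (i * w).
  by rewrite iw mulrDl -[i * x * i * i]mulrA ii mulrN1 opprB.
have w0 : w != 0.
  by apply/eqP => w0; apply: xi; apply/esym/subr0_eq; rewrite -iw w0 mulr0.
clearbody w; have wi0 : w * i != 0.
  apply/eqP => /division_mul_eq0[/eqP|i0]; first by rewrite (negPf w0).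
  by move: ii; rewrite i0 mulr0 => /eqP; rewrite eq_sym oppr_eq0 oner_eq0.
have wwi : w * w * i = i * (w * w).
  by rewrite -mulrA wi mulrN mulrA wi mulNr opprK mulrA.
have [a [c ww]] := commutant_imaginary ii wwi.
have c0 : c = 0.
  have : w * (w * w) = w * w * w by rewrite mulrA.
  rewrite ww mulrDr mulrDl scalar_comm => /eqP.
  rewrite (inj_eq (addrI _)) => /eqP; rewrite -scalerAr -scalerAl => /eqP.
  rewrite -subr_eq0 -scalerBr scaler_eq0.
  case/orP => [/eqP//|]; rewrite subr_eq0 => /eqP wiE.
  by move: wi0; rewrite (double_eq0 (x := w * i)) ?eqxx// {2}wiE wi.
rewrite c0 scale0r addr0 in ww.
have [a0|a0] := ltP a 0; last first.
  have w1 : w * 1 = 1 * w by rewrite mulr1 mul1r.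
  have wwa : w * w = (Num.sqrt a) ^+ 2 *: (1 * 1) by rewrite sqr_sqrtr// mulr1.
  have wiE : w * i = i * w.
    by have [->|->] := comm_root w1 wwa; rewrite ?mulNr ?mulrN scalar_comm.
  by move: wi0; rewrite (double_eq0 (x := w * i)) ?eqxx// {2}wiE wi.
pose t := Num.sqrt (- a).
have t2 : t ^+ 2 = - a by rewrite sqr_sqrtr// oppr_ge0 ltW.
exists (t^-1 *: w); split.
  rewrite -scalerAl -scalerAr scalerA ww scalerA -invfM -expr2 t2.
  by rewrite invrN mulNr mulVf ?lt_eqF// scaleN1r.
by rewrite -scalerAl -scalerAr wi scalerN.
Qed.

(** Up to a factor [2], [x] is the sum of [u], which commutes with [i], and
of [v], which anticommutes with it; [v * j] commutes with [i] again, so both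
[u] and [v * j] have complex coordinates. *)
Lemma quaternion_coordinates i j : i * i = -1 -> j * j = -1 ->
  j * i = - (i * j) -> forall x, exists q, quat_eval i j (i * j) q = x.
Proof.
move=> ii jj ji x.
pose u := x - i * x * i; pose v := x + i * x * i.
have ui : u * i = i * u.
  have e1 : i * x * i * i = - (i * x) by rewrite -mulrA ii mulrN1.
  have e2 : i * (i * x * i) = - (x * i) by rewrite !mulrA ii mulN1r mulNr.
  by rewrite /u mulrBl mulrBr e1 e2 !opprK addrC.
have vi : v * i = - (i * v).
  have e1 : i * x * i * i = - (i * x) by rewrite -mulrA ii mulrN1.
  have e2 : i * (i * x * i) = - (x * i) by rewrite !mulrA ii mulN1r mulNr.
  by rewrite /v mulrDl mulrDr e1 e2 opprB.
have vji : v * j * i = i * (v * j).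
  by rewrite -mulrA ji mulrN mulrA vi mulNr opprK mulrA.
have [a [b uE]] := commutant_imaginary ii ui.
have [c [d vE]] := commutant_imaginary ii vji.
exists (2^-1 *: Quat a b (- c) (- d)).
have -> : x = 2^-1 *: (u + v).
  rewrite addrACA addNr addr0 -mulr2n -[x *+ 2]scaler_nat scalerA mulVf ?scale1r//.
clearbody u v.
have -> : v = - (v * j) * j by rewrite mulNr -mulrA jj mulrN1 opprK.
rewrite vE uE quat_evalZ; congr (_ *: _).
rewrite /quat_eval /= mulNr mulrDl mulr_algl -scalerAl !scaleNr opprD addrA.
by [].
Qed.

Theorem frobenius_embedding :
  exists f : D -> quat R, [/\ linear f, {morph f : x y / x * y} & f 1 = 1].
Proof.
have [allR|notR] := pselect (forall x : D, exists s : R, x = s%:A).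
  apply: (@quat_embedding R D 0 0 0 [set q | [/\ qi q = 0, qj q = 0 & qk q = 0]]).
  - by [].
  - by move=> t q r [q1 q2 q3] [r1 r2 r3];
      split; rewrite /= ?q1 ?q2 ?q3 ?r1 ?r2 ?r3 mulr0 addr0.
  - by move=> q [q1 q2 q3]; split; rewrite /= ?q1 ?q2 ?q3 oppr0.
  - move=> [a b c d] [a' b' c' d'] /= [-> -> ->] [-> -> ->].
    split; first by split => /=; ring.
    by rewrite /quat_eval /= !scaler0 !addr0 !mulr0 !subr0 mulr_algl scalerA.
  - move=> x; have [s ->] := allR x; exists (Quat s 0 0 0) => //.
    by rewrite quat_eval_real.
have [i ii] : exists i : D, i * i = -1.
  apply: exists_imaginary; apply: contrapT => noR; apply: notR => x.
  apply: contrapT => nx; apply: noR; exists x => s; apply/eqP => xs.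
  by apply: nx; exists s.
have [comm_i|ncomm_i] := pselect (forall x : D, x * i = i * x).
  apply: (@quat_embedding R D i 0 0 [set q | qj q = 0 /\ qk q = 0]).
  - by [].
  - by move=> t q r [q2 q3] [r2 r3]; split; rewrite /= ?q2 ?q3 ?r2 ?r3 mulr0 addr0.
  - by move=> q [q2 q3]; split; rewrite /= ?q2 ?q3 oppr0.
  - move=> [a b c d] [a' b' c' d'] /= [-> ->] [-> ->].
    split; first by split => /=; ring.
    rewrite /quat_eval /= !scaler0 !addr0 !mulr0 !subr0 !addr0.
    rewrite mulrDl !mulrDr -!scalerAl -!scalerAr ii !(mul1r, mulr1) !scalerA.
    rewrite scalerN scalerBl scalerDl [RHS]addrACA [_ *: i + - _]addrC addrACA.
    by rewrite addrACA [RHS]addrACA; congr (_ + _); exact: addrC.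
  - move=> x; have [a [c ->]] := commutant_imaginary ii (comm_i x).
    by exists (Quat a c 0 0) => //; rewrite /quat_eval /= !scaler0 !addr0.
have [x xi] : exists x : D, x * i <> i * x.
  apply: contrapT => nx; apply: ncomm_i => x; apply: contrapT => xi.
  by apply: nx; exists x.
have [j [jj ji]] := exists_anticommuting ii (ex_intro _ x xi).
apply: (@quat_embedding R D i j (i * j) setT) => //.
  by move=> q r _ _; split => //; exact: quat_evalM.
move=> y; have [q <-] := quaternion_coordinates ii jj ji y.
by exists q.
Qed.

End Frobenius.

(** * Neumann series *)
Section BanachAlgebra.
Variables (R : realType) (A : algType R) (p : R) (nrm : A -> R).
Hypotheses (p_gt0 : 0 < p) (nrmP : p_banach_norm p nrm).
Implicit Types (a b : A).

Lemma p_banach_seminorm : p_seminorm p nrm.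
Proof.
have N := pbn_norm nrmP.
split; [exact: phn_ge0 N|exact: phn_triangle N|exact: phn_homogeneous N|].
exact: pbn_submult nrmP.
Qed.
Let nP := p_banach_seminorm.

Lemma cvg0_le0 (X : R) (f : nat -> R) :
  f n @[n --> \oo] --> (0 : R) -> (forall n, X <= f n) -> X <= 0.
Proof.
move=> f0 Xf; rewrite leNgt; apply/negP => X0.
have [N _ /(_ N (leqnn N))] := cvgr_lt _ f0 _ X0.
by rewrite /= ltNge Xf.
Qed.

Lemma nrm_exp_cvg0 (y : A) (C : R) : nrm y < 1 ->
  C * (nrm 1 * nrm y ^+ n) @[n --> \oo] --> (0 : R).
Proof.
move=> y1; have -> : 0 = C * (nrm 1 * 0) by rewrite !mulr0.
by apply: cvgMr; apply: cvgMr; apply: cvg_expr; rewrite ger0_norm ?(psn_ge0 nP).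
Qed.

Lemma geometric_sum_bounded (y : A) : nrm y < 1 ->
  forall n, nrm (\sum_(i < n) y ^+ i) <= nrm 1 / (1 - nrm y).
Proof.
move=> y1 n; have y0 := psn_ge0 nP y.
rewrite (le_trans (psn_sum p_gt0 nP _))//.
apply: (@le_trans _ _ (\sum_(i < n) nrm 1 * nrm y ^+ i)).
  by apply: ler_sum => i _; exact: (psn_exp nP).
rewrite -mulr_sumr ler_wpM2l ?(psn_ge0 nP)//.
rewrite -[leRHS]mul1r ler_pdivlMr ?subr_gt0// mulrC -opprB mulNr -subrX1 opprB.
by rewrite lerBlDr lerDl exprn_ge0 ?(psn_ge0 nP).
Qed.

Lemma geometric_sum_tail (y : A) n k :
  \sum_(i < n + k) y ^+ i - \sum_(i < n) y ^+ i
  = y ^+ n * \sum_(i < k) y ^+ i.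
Proof.
rewrite big_split_ord /= addrAC subrr add0r mulr_sumr.
by apply: eq_bigr => i _; rewrite exprD.
Qed.

(** The partial sums of the geometric series are Cauchy because a tail is
[y^n] times a bounded partial sum; the limit is a two-sided inverse since
[(1 - y) * u n = 1 - y^n]. *)
Lemma neumann (y : A) : nrm y < 1 -> invertible (1 - y).
Proof.
move=> y1; pose u n := \sum_(i < n) y ^+ i.
have uE n : (1 - y) * u n = 1 - y ^+ n.
  by rewrite -opprB mulNr -subrX1 opprB.
have uy n : u n * (1 - y) = (1 - y) * u n.
  by apply: commr_sym; apply: commr_sum => i _; apply: commrX; apply: commr_sym;
     apply: commrB => //; exact: commr1.
have [l ul] : exists l, nrm (u n - l) @[n --> \oo] --> (0 : R).
  apply: (pbn_complete nrmP) => e e0.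
  have c0 := nrm_exp_cvg0 (nrm 1 / (1 - nrm y)) y1.
  have [N _ NP] := cvgr_lt _ c0 _ e0.
  have tail n k : (N <= n)%N -> nrm (u (n + k)%N - u n) < e.
    move=> /NP; apply: le_lt_trans.
    rewrite geometric_sum_tail [leRHS]mulrC.
    rewrite (le_trans (psn_submult nP _ _))// ler_pM//.
    - exact: psn_ge0 nP _.
    - exact: psn_ge0 nP _.
    - exact: (psn_exp nP).
    - exact: geometric_sum_bounded.
  exists N => i j Ni Nj; have [ij|/ltnW ji] := leqP i j.
    by rewrite -(subnKC ij) -opprB (psn_opp nP) tail.
  by rewrite -(subnKC ji) tail.
have lim1 (z : A) (f : A -> A) : (forall n, z = f (u n - l) + y ^+ n) ->
    (forall a, nrm (f a) <= nrm (1 - y) * nrm a) -> z = 0.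
  move=> zE fP; apply: (phn_definite (pbn_norm nrmP)).
  apply/eqP; rewrite eq_le (psn_ge0 nP) andbT.
  pose g n := nrm (1 - y) * nrm (u n - l) + 1 * (nrm 1 * nrm y ^+ n).
  apply: (@cvg0_le0 _ g).
    have -> : 0 = nrm (1 - y) * 0 + 0 by rewrite mulr0 addr0.
    apply: cvgD.
      by apply: cvgMr; exact: ul.
    exact: nrm_exp_cvg0.
  move=> n; rewrite (zE n) (le_trans (psn_triangle nP _ _))// /g mul1r lerD//.
  exact: (psn_exp nP).
exists l; split; apply/eqP; rewrite eq_sym -subr_eq0; apply/eqP.
  apply: (lim1 _ (fun a => (1 - y) * a)).
    by move=> n; rewrite mulrBr uE addrAC subrK.
  by move=> a; exact: psn_submult nP _ _.
apply: (lim1 _ (fun a => a * (1 - y))).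
  by move=> n; rewrite mulrBl uy uE addrAC subrK.
by move=> a; rewrite [leRHS]mulrC; exact: psn_submult nP _ _.
Qed.

End BanachAlgebra.

(** * Quaternion-valued characters are contractive *)
Section QuaternionIdentities.
Variable R : realType.
Implicit Types (q : quat R) (t : R).

Lemma quat_quadratic q :
  (2 * qre q) *: q - q ^+ 2 = (sqnormq q)%:A.
Proof.
by case: q => a b c d; rewrite expr2; congr Quat; rewrite /sqnormq /=; ring.
Qed.

(** The square of [q - s] is the nonpositive real number [- t^2], so [q - s] is
purely imaginary: a quaternion with nonzero real part has a real square only if
it is real itself, and then the square is positive. *)
Lemma quat_sqnorm_root q (s t : R) :
  (q - s%:A) ^+ 2 + (t ^+ 2)%:A = 0 -> sqnormq q = s ^+ 2 + t ^+ 2.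
Proof.
case: q => a b c d; rewrite expr2 => -[] /= e0 e1 e2 e3.
rewrite /sqnormq /=; have [as0|as0] := eqVneq (a - s) 0.
  have aE : a = s by apply/eqP; rewrite -subr_eq0 as0.
  by rewrite aE in e0 *; lra.
have im0 (y : R) : 2 * ((a - s) * y) = 0 -> y = 0.
  by move=> /eqP; rewrite !mulf_eq0 (negPf as0) pnatr_eq0 => /eqP.
have b0 : b = 0 by apply: im0; rewrite -e1; ring.
have c0 : c = 0 by apply: im0; rewrite -e2; ring.
have d0 : d = 0 by apply: im0; rewrite -e3; ring.
have : (a - s) ^+ 2 + t ^+ 2 = 0 by rewrite -e0 b0 c0 d0; ring.
move=> /eqP; rewrite paddr_eq0 ?sqr_ge0// sqrf_eq0 (negPf as0).
by [].
Qed.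

Lemma quat_norm_sqr q : `|q| ^+ 2 = sqnormq q.
Proof. by rewrite Defs.normqE sqr_sqrtr// sqnormq_ge0. Qed.

Lemma quat_norm1 : `|1 : quat R| = 1.
Proof.
rewrite Defs.normqE /Defs.normq /sqnormq /= expr0n /= !addr0 expr1n sqrtr1.
by [].
Qed.

End QuaternionIdentities.

Section CharacterBound.
Variables (R : realType) (A : algType R) (p : R) (nrm : A -> R).
Hypotheses (p_gt0 : 0 < p) (nrmP : p_banach_norm p nrm).
Let nP := p_banach_seminorm nrmP.
Implicit Types (a b : A) (x : qchar A).

Lemma qchar1 x : x 1 = 1.
Proof.
have xx : x 1 * (x 1 - 1) = 0 by rewrite mulrBr mulr1 -qcharM mulr1 subrr.
have : `|x 1| * `|x 1 - 1| = 0 by rewrite -normqM xx normr0.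
move=> /eqP; rewrite mulf_eq0 !normr_eq0 subr_eq0 => /orP[/eqP x1|/eqP//].
have [a] := qchar_neq0 x; rewrite -[a]mul1r qcharM x1 mul0r.
by rewrite eqxx.
Qed.

Lemma qchar_scalar x (t : R) : x t%:A = t%:A.
Proof. by rewrite linearZ /= qchar1. Qed.

Lemma qcharX x a n : x (a ^+ n) = x a ^+ n.
Proof.
by elim: n => [|n IH]; rewrite ?expr0 ?qchar1// !exprS qcharM IH.
Qed.

Lemma qchar_invertible x a : invertible a -> x a != 0.
Proof.
move=> [b [ab _]]; apply/eqP => xa0.
have := qcharM x a b; rewrite ab xa0 mul0r qchar1 => /eqP.
by rewrite oner_eq0.
Qed.

Lemma quat_normX (q : quat R) n : `|q ^+ n| = `|q| ^+ n.
Proof.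
elim: n => [|n IH]; first by rewrite !expr0 quat_norm1.
by rewrite !exprS normqM IH.
Qed.

Lemma nrm_exp_small a (e : R) : 0 < e -> nrm a < 1 -> exists n, nrm (a ^+ n) < e.
Proof.
move=> e0 a1; have [N _ NP] := cvgr_lt _ (nrm_exp_cvg0 nrmP 1 a1) _ e0.
exists N; rewrite (le_lt_trans (psn_exp nP _ _))//.
by have := NP N (leqnn N); rewrite /= mul1r.
Qed.

Lemma nrm_quadratic_le a (s : R) :
  nrm ((2 * s) *: a - a ^+ 2) <= (`|2 * s| `^ p + nrm a) * nrm a.
Proof.
rewrite (le_trans (psn_sub nP _ _))// (psn_homogeneous nP) [leRHS]mulrDl lerD2l.
by rewrite expr2 (psn_submult nP).
Qed.

(** If [|x a| = 1], all powers [b = a^n] have [|x b| = 1], and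
[nrm b] can be made small.  With [s] the real part of [x b], the element
[c = 2 s b - b^2] satisfies [x c = 1] while [nrm c < 1], so that [x] would
kill the invertible element [1 - c]. *)
Lemma qchar_norm_lt1 x a : nrm a < 1 -> `|x a| != 1.
Proof.
move=> a1; apply/eqP => xa.
have two0 : 0 <= (2 : R) `^ p by exact: powR_ge0.
(* The bound that makes [nrm b * (2 `^ p + nrm b)] at most [1 / 2]. *)
have [] := @nrm_exp_small a (2 * (2 `^ p + 1))^-1 _ a1.
  by rewrite invr_gt0; lra.
move=> n; set b := a ^+ n => bn.
have b0 := psn_ge0 nP b.
have xb : sqnormq (x b) = 1.
  by rewrite -quat_norm_sqr /b qcharX quat_normX xa !expr1n.
clearbody b; have := quat_quadratic (x b); rewrite xb scale1r.
have [s sE] : exists s, qre (x b) = s by exists (qre (x b)).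
rewrite sE => xc.
have s1 : `|s| <= 1.
  rewrite -(expr_le1 (n := 2))// real_normK ?num_real//.
  rewrite -xb /sqnormq -sE -!addrA lerDl.
  by rewrite !addr_ge0// sqr_ge0.
have : nrm ((2 * s) *: b - b ^+ 2) < 1.
  rewrite (le_lt_trans (nrm_quadratic_le _ _))//.
  have : `|2 * s| `^ p <= 2 `^ p.
    by rewrite ge0_ler_powR ?nnegrE// ?(ltW p_gt0)// normrM ger0_norm// ler_piMr.
  move: (`|2 * s| `^ p) (2 `^ p) two0 bn => S T T0 bn ST.
  have bn1 : nrm b * (2 * (T + 1)) < 1.
    by rewrite -ltr_pdivlMr ?div1r//; lra.
  have bT : 0 <= nrm b * T by rewrite mulr_ge0.
  have bS : S * nrm b <= T * nrm b by rewrite ler_wpM2r.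
  have bb : nrm b * nrm b <= 1 * nrm b by rewrite ler_wpM2r//; lra.
  lra.
move=> /(neumann p_gt0 nrmP)/(qchar_invertible x).
by rewrite linearB linearB linearZ /= qchar1 qcharX xc subrr eqxx.
Qed.

Lemma qchar_norm_le x a : `|x a| <= nrm a `^ p^-1.
Proof.
rewrite leNgt; apply/negP => lt_a.
set r := `|x a| in lt_a.
have r0 : 0 < r by rewrite (le_lt_trans (powR_ge0 _ _) lt_a).
have a0 := psn_ge0 nP a.
have ra : nrm a < r `^ p.
  have -> : nrm a = (nrm a `^ p^-1) `^ p.
    by rewrite -powRrM mulVf ?gt_eqF// powRr1.
  by rewrite gt0_ltr_powR ?nnegrE ?powR_ge0// ltW.
have : nrm (r^-1 *: a) < 1.
  rewrite (psn_homogeneous nP) gtr0_norm ?invr_gt0//.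
  rewrite -[r^-1]powR_inv1 ?(ltW r0)// -powRrM mulN1r powRN mulrC.
  by rewrite ltr_pdivrMr ?powR_gt0// mul1r.
move=> /(qchar_norm_lt1 x); rewrite linearZ /= normrZ.
by rewrite gtr0_norm ?invr_gt0// mulVf ?eqxx// gt_eqF.
Qed.

End CharacterBound.

(** * Conjugation orbits and maximal left ideals *)
Section SpectrumBound.
Variables (R : realType) (A : algType R) (p : R) (nrm : A -> R).
Hypotheses (p_gt0 : 0 < p) (nrmP : p_banach_norm p nrm).
Let nP := p_banach_seminorm nrmP.
Implicit Types (a b u v : A).

Definition quadratic a (s t : R) : A := (a - s%:A) ^+ 2 + (t ^+ 2)%:A.

Lemma spectrumP a (z : R[i]) :
  spectrum a z <-> ~ invertible (quadratic a (complex.Re z) (complex.Im z)).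
Proof. by []. Qed.

Lemma complex_normE (z : R[i]) :
  complex.Re `|z| = Num.sqrt (complex.Re z ^+ 2 + complex.Im z ^+ 2).
Proof. by rewrite normc_def. Qed.

(** For [s + it] far from the origin the first term dominates, and a Neumann
series inverts the difference. *)
Lemma quadraticE a (s t : R) :
  quadratic a s t = (s ^+ 2 + t ^+ 2)%:A - ((2 * s) *: a - a ^+ 2).
Proof.
rewrite /quadratic !expr2 mulrBl !mulrBr mulr_algr !mulr_algl scalerA.
rewrite (mulr_natl s 2) mulr2n !scalerDl !opprB addrACA -opprD addrAC.
by rewrite -[LHS]addrA; exact: addrC.
Qed.

Lemma invertibleZ (r : R) a : r != 0 -> invertible a -> invertible (r *: a).
Proof.
move=> r0 [b [ab ba]]; exists (r^-1 *: b).
by rewrite -!scalerAl -!scalerAr !scalerA ab ba mulVf// mulfV// scale1r.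
Qed.

Lemma quadratic_invertible a (s t : R) : 0 < s ^+ 2 + t ^+ 2 ->
  (`|2 * s| `^ p + nrm a) * nrm a < (s ^+ 2 + t ^+ 2) `^ p ->
  invertible (quadratic a s t).
Proof.
rewrite quadraticE; set r := s ^+ 2 + t ^+ 2 => r0 lt_r.
have -> : r%:A - ((2 * s) *: a - a ^+ 2)
    = r *: (1 - r^-1 *: ((2 * s) *: a - a ^+ 2)).
  by rewrite [RHS]scalerBr scalerA mulfV ?gt_eqF// scale1r.
apply: invertibleZ; first by rewrite gt_eqF.
apply: (neumann p_gt0 nrmP); rewrite (psn_homogeneous nP) gtr0_norm ?invr_gt0//.
rewrite -[r^-1]powR_inv1 ?(ltW r0)// -powRrM mulN1r powRN mulrC.
rewrite ltr_pdivrMr ?powR_gt0// mul1r (le_lt_trans _ lt_r)//.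
exact: nrm_quadratic_le.
Qed.

Lemma spectrum_bounded a :
  exists M : R, forall z, spectrum a z -> complex.Re `|z| <= M.
Proof.
pose K := (2 `^ p + nrm a) * nrm a.
have a0 := psn_ge0 nP a.
have K0 : 0 <= K by rewrite mulr_ge0// addr_ge0// powR_ge0.
(* For [|z|^p > K + 1 >= 1], both terms of the quadratic are dominated by
   [|z|^(2 p)]. *)
exists ((K + 1) `^ p^-1) => z spz; rewrite leNgt; apply/negP => zM; apply: spz.
apply: quadratic_invertible.
  by rewrite -sqrtr_gt0 -complex_normE (le_lt_trans _ zM)// powR_ge0.
move: zM; rewrite complex_normE.
set s := complex.Re z; set t := complex.Im z; set r := Num.sqrt _ => zM.
have r0 : 0 <= r by exact: sqrtr_ge0.
have r2 : s ^+ 2 + t ^+ 2 = r * r.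
  by rewrite -expr2 sqr_sqrtr// addr_ge0// sqr_ge0.
have rp : K + 1 < r `^ p.
  have -> : K + 1 = ((K + 1) `^ p^-1) `^ p.
    by rewrite -powRrM mulVf ?gt_eqF// powRr1//; lra.
  by rewrite gt0_ltr_powR ?nnegrE ?powR_ge0.
have sr : `|s| <= r.
  by rewrite -sqrtr_sqr ler_wsqrtr// lerDl sqr_ge0.
rewrite r2 powRM//.
have : `|2 * s| `^ p <= 2 `^ p * r `^ p.
  rewrite -powRM// ge0_ler_powR ?nnegrE ?mulr_ge0 ?(ltW p_gt0)//.
  by rewrite normrM ger0_norm// ler_wpM2l.
have : 0 <= 2 `^ p :> R := powR_ge0 _ _.
clear zM.
move: (r `^ p) (2 `^ p) (`|2 * s| `^ p) @K K0 rp => Q T S K K0 rp T0 SQ.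
have e1 : S * nrm a <= T * Q * nrm a by rewrite ler_wpM2r.
have e2 : nrm a * nrm a <= Q * (nrm a * nrm a).
  by rewrite ler_peMl ?mulr_ge0//; lra.
have e3 : K * Q < Q * Q by rewrite ltr_pM2r; lra.
rewrite mulrDl (le_lt_trans _ e3)//.
have -> : K * Q = T * Q * nrm a + Q * (nrm a * nrm a) by rewrite /K; ring.
exact: lerD.
Qed.

Lemma quadratic_conj a u v (s t : R) : u * v = 1 -> v * u = 1 ->
  quadratic (u * a * v) s t = u * quadratic a s t * v.
Proof.
move=> uv vu.
have cE (r : R) : r%:A = u * r%:A * v by rewrite mulr_algr -scalerAl uv.
rewrite /quadratic mulrDr mulrDl -cE; congr (_ + _).
have -> : u * a * v - s%:A = u * (a - s%:A) * v.
  by rewrite mulrBr mulrBl -cE.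
by rewrite !expr2 !mulrA; congr (_ * _); rewrite -!mulrA; congr (_ * (_ * _));
   rewrite [v * (u * _)]mulrA vu mul1r.
Qed.

Lemma spectrum_conj a u v : u * v = 1 -> v * u = 1 ->
  spectrum (u * a * v) `<=` spectrum a.
Proof.
move=> uv vu z; rewrite !spectrumP; apply: contra_not => -[c [ac ca]].
rewrite quadratic_conj//; exists (u * c * v).
have cancel x y : u * x * v * (u * y * v) = u * (x * y) * v.
  by rewrite !mulrA; congr (_ * _); rewrite -!mulrA; congr (_ * (_ * _));
   rewrite [v * (u * _)]mulrA vu mul1r.
by rewrite !cancel ac ca mulr1.
Qed.

Variable m : R.
Hypothesis m_gt0 : 0 < m.
Hypothesis nrm_radius : forall a : A,
  ((nrm a `^ p^-1)%:E <= m%:E * spectral_radius a)%E.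

(** The spectrum, hence the spectral radius, is invariant under conjugation. *)
Lemma nrm_conj_bounded a : exists C : R, forall u v,
  u * v = 1 -> v * u = 1 -> nrm (u * a * v) <= C.
Proof.
have [M HM] := spectrum_bounded a.
exists ((m * M) `^ p) => u v uv vu; set b := u * a * v.
have b0 := psn_ge0 nP b.
have bM : nrm b `^ p^-1 <= m * M.
  rewrite -lee_fin (le_trans (nrm_radius b))// EFinM lee_pmul2l ?lte_fin//.
  apply: ge_ereal_sup => _ [z bz <-]; rewrite lee_fin.
  by apply: HM; exact: spectrum_conj bz.
have -> : nrm b = (nrm b `^ p^-1) `^ p.
  by rewrite -powRrM mulVf ?gt_eqF// powRr1.
rewrite ge0_ler_powR ?nnegrE ?powR_ge0 ?(ltW p_gt0)//.
by rewrite (le_trans _ bM)// powR_ge0.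
Qed.

Record left_ideal (L : set A) : Prop := {
  lideal0 : L 0;
  lidealB : forall a b, L a -> L b -> L (a - b);
  lidealM : forall a b, L b -> L (a * b);
  lideal_proper : ~ L 1 }.

(** Maximality in the form [A b + L = A] for every [b] outside [L]. *)
Definition maximal_left_ideal (L : set A) : Prop :=
  left_ideal L /\ forall b, ~ L b -> exists d, L (d * b - 1).

Lemma lideal_invertible L a : left_ideal L -> L a -> ~ invertible a.
Proof.
by move=> LP La [b [_ ba]]; apply: (lideal_proper LP); rewrite -ba; exact: lidealM.
Qed.

Lemma lidealN L a : left_ideal L -> L a -> L (- a).
Proof.
by move=> LP La; rewrite -sub0r; apply: (lidealB LP) => //; exact: lideal0.
Qed.

Lemma lidealD L a b : left_ideal L -> L a -> L b -> L (a + b).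
Proof.
by move=> LP La Lb; rewrite -[b]opprK; apply: (lidealB LP) => //; exact: lidealN.
Qed.

Lemma lidealZ L (t : R) a : left_ideal L -> L a -> L (t *: a).
Proof. by move=> LP La; rewrite -mulr_algl; exact: lidealM. Qed.

Section TwoSided.
Variable L : set A.
Hypothesis maxL : maximal_left_ideal L.
Let LP : left_ideal L := proj1 maxL.

(** Modulo [L], the element [u] fixes [1] and sends [b] to [b + t], so
[u^n] sends [b] to [b + n t]; right multiplication by [v^n] acts trivially
because [v^n] is [1] modulo the left ideal [L]. *)
Lemma transvection_orbit b c (t : R) v (u := 1 + t *: c) :
  L c -> L (c * b - 1) -> u * v = 1 -> v * u = 1 ->
  forall n, L (u ^+ n * b * v ^+ n - b - (t *+ n)%:A).
Proof.
move=> Lc Lcb uv vu.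
have Lv : L (v - 1).
  have -> : v - 1 = (- (t *: v)) * c.
    rewrite -{1}vu /u mulrDr mulr1 opprD addrA subrr sub0r mulNr -scalerAl.
    by rewrite scalerAr.
  exact: lidealM.
have Lvn n : L (v ^+ n - 1).
  elim: n => [|n IH]; first by rewrite expr0 subrr; exact: lideal0.
  have -> : v ^+ n.+1 - 1 = v * (v ^+ n - 1) + (v - 1).
    by rewrite mulrBr mulr1 exprS addrA subrK.
  by apply: (lidealD LP) => //; exact: lidealM.
have Lun n : L (u ^+ n * b - b - (t *+ n)%:A).
  elim: n => [|n IH].
    by rewrite expr0 mul1r mulr0n scale0r subrr subr0; exact: lideal0.
  have -> : u ^+ n.+1 * b - b - (t *+ n.+1)%:A
    = u * (u ^+ n * b - b - (t *+ n)%:A) + (t *: (c * b - 1) + ((t *+ n) * t) *: c).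
    rewrite exprS -mulrA !mulrBr [u * b]mulrDl mul1r mulr_algr /u scalerDr.
    rewrite scalerBr scalerA mulrSr -scalerAl [(_ + t)%:A]scalerDl !opprD !addrA.
    by rewrite [RHS](ACl (1*2*4*7*3*6*5*8)) /= !subrK.
  apply: (lidealD LP); first exact: lidealM.
  by apply: (lidealD LP); exact: lidealZ.
move=> n; have -> : u ^+ n * b * v ^+ n - b - (t *+ n)%:A
    = u ^+ n * b * (v ^+ n - 1) + (u ^+ n * b - b - (t *+ n)%:A).
  by rewrite mulrBr mulr1 !addrA subrK.
by apply: (lidealD LP) => //; exact: lidealM.
Qed.

(** Dividing the bounded element [w = u^n b v^n - b] by [n t] makes its norm less
than [1], so [1 - w / (n t)] is invertible; but it lies in [L]. *)
Theorem maximal_left_ideal_two_sided c b : L c -> L (c * b).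
Proof.
move=> Lc; apply: contrapT => /(proj2 maxL)[d]; rewrite mulrA => Ldcb.
have {Lc} : L (d * c) by exact: lidealM.
move: (d * c) Ldcb => {d}c Lcb Lc.
have [t [t0 tc]] : exists t : R, 0 < t /\ nrm (- (t *: c)) < 1.
  have c1 : 0 < nrm c + 1 by rewrite ltr_wpDl// (psn_ge0 nP).
  exists ((nrm c + 1)^-1 `^ p^-1); split; first by rewrite powR_gt0 ?invr_gt0.
  rewrite (psn_opp nP) (psn_homogeneous nP) ger0_norm ?powR_ge0//.
  rewrite -powRrM mulVf ?gt_eqF// powRr1 ?invr_ge0 ?ltW//.
  by rewrite mulrC ltr_pdivrMr// mul1r ltrDl.
have := neumann p_gt0 nrmP tc; rewrite opprK => -[v [uv vu]].
have orbit := transvection_orbit Lc Lcb uv vu.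
set u := 1 + t *: c in uv vu orbit.
have uvn n : u ^+ n * v ^+ n = 1.
  by rewrite -exprMn_comm ?uv ?expr1n// /GRing.comm uv vu.
have vun n : v ^+ n * u ^+ n = 1.
  by rewrite -exprMn_comm ?vu ?expr1n// /GRing.comm uv vu.
have [C HC] := nrm_conj_bounded b.
pose w n := u ^+ n * b * v ^+ n - b.
have wC n : nrm (w n) <= C + nrm b.
  by rewrite (le_trans (psn_sub nP _ _))// lerD// HC.
have C0 : 0 <= C + nrm b := le_trans (psn_ge0 nP _) (wC 0%N).
have [n [n0 nlt]] : exists n, (0 < n)%N /\ C + nrm b < (t *+ n) `^ p.
  pose K := (C + nrm b) `^ p^-1.
  exists (Num.bound (K / t)).+1; split => //.
  have -> : C + nrm b = K `^ p by rewrite -powRrM mulVf ?gt_eqF// powRr1.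
  rewrite gt0_ltr_powR ?nnegrE ?powR_ge0 ?mulrn_wge0 ?(ltW t0)//.
  rewrite -mulr_natr mulrC -ltr_pdivrMr//.
  rewrite (lt_le_trans (archi_boundP _)) ?divr_ge0 ?powR_ge0 ?(ltW t0)//.
  by rewrite ler_nat.
have tn0 : 0 < t *+ n by rewrite pmulrn_lgt0.
have : nrm ((t *+ n)^-1 *: w n) < 1.
  rewrite (psn_homogeneous nP) gtr0_norm ?invr_gt0//.
  rewrite -[_^-1]powR_inv1 ?(ltW tn0)// -powRrM mulN1r powRN mulrC.
  by rewrite ltr_pdivrMr ?powR_gt0// mul1r (le_lt_trans (wC n)).
move=> /(neumann p_gt0 nrmP) inv; apply: (lideal_invertible LP) inv.
move: (orbit n); rewrite -/(w n); move: (w n) => x Lx.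
have -> : 1 - (t *+ n)^-1 *: x = (- (t *+ n)^-1) *: (x - (t *+ n)%:A).
  by rewrite scaleNr scalerBr scalerA mulVf ?gt_eqF// scale1r opprB.
exact: lidealZ.
Qed.

End TwoSided.

End SpectrumBound.

(** * Maximal ideals and division algebra quotients *)
Section MaximalIdeals.
Variables (R : realType) (A : algType R).
Implicit Types (a b : A) (L : set A).

Lemma chain_left_ideal L0 (F : set (set A)) L1 :
  F `<=` [set L | L = set0 \/ left_ideal L /\ L0 `<=` L] ->
  total_on F subset -> F L1 -> L1 !=set0 ->
  left_ideal (\bigcup_(L in F) L) /\ L0 `<=` \bigcup_(L in F) L.
Proof.
move=> FP Ftot FL1 [x1 Lx1].
have FN L x : F L -> L x -> left_ideal L /\ L0 `<=` L.
  by move=> FL Lx; have [L0'|//] := FP _ FL; move: Lx; rewrite L0'.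
have [LP1 L01] := FN _ _ FL1 Lx1.
split; last by move=> x /L01; exists L1.
split.
- by exists L1 => //; exact: lideal0.
- move=> a b [L FL La] [M FM Mb].
  have [LM|ML] := Ftot _ _ FL FM.
    by exists M => //; apply: (lidealB (FN _ _ FM Mb).1) => //; exact: LM.
  by exists L => //; apply: (lidealB (FN _ _ FL La).1) => //; exact: ML.
- by move=> a b [L FL Lb]; exists L => //; exact: (lidealM (FN _ _ FL Lb).1).
- by move=> [L FL L1']; exact: (lideal_proper (FN _ _ FL L1').1).
Qed.

(** The empty set is admitted in the ordered family because the union of the empty
chain is empty. *)
Lemma exists_maximal_left_ideal L0 : left_ideal L0 ->
  exists2 L, maximal_left_ideal L & L0 `<=` L.
Proof.
move=> LP0.
have [|L [PL maxL]] :=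
    @Zorn_bigcup A [set L | L = set0 \/ left_ideal L /\ L0 `<=` L].
  move=> F FP Ftot.
  have [[L1 [FL1 L1n]]|none] := pselect (exists L, F L /\ L !=set0).
    by right; exact: chain_left_ideal FL1 L1n.
  left; apply/seteqP; split=> // x [L FL Lx]; apply: none.
  by exists L; split => //; exists x.
have {PL} [LP L0L] : left_ideal L /\ L0 `<=` L.
  case: PL => // LE; exfalso; apply: (maxL L0); last by right; split=> // x.
  rewrite LE; split => // L00.
  by have := L00 _ (lideal0 LP0).
exists L => //; split => // b Lb; apply: contrapT => nod.
pose M := [set x | exists d l, L l /\ x = l + d * b].
apply: (maxL M).
  split; first by move=> x Lx; exists 0, x; rewrite mul0r addr0.
  by move=> ML; apply: Lb; apply: ML; exists 1, 0; rewrite mul1r add0r;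
     split => //; exact: lideal0.
right; split; last by move=> x /L0L Lx; exists 0, x; rewrite mul0r addr0.
split.
- by exists 0, 0; rewrite mul0r addr0; split => //; exact: lideal0.
- move=> _ _ [d [l [Ll ->]]] [e [k [Lk ->]]]; exists (d - e), (l - k).
  by split; [exact: (lidealB LP)|rewrite mulrBl opprD addrACA].
- move=> a _ [d [l [Ll ->]]]; exists (a * d), (a * l).
  by split; [exact: (lidealM LP)|rewrite mulrDr mulrA].
- move=> [d [l [Ll l1]]]; apply: nod; exists d; rewrite l1.
  by rewrite opprD addrC subrK; exact: lidealN.
Qed.

Lemma principal_left_ideal (c : A) : (forall d, d * c <> 1) ->
  left_ideal [set x : A | exists d, x = d * c].
Proof.
move=> nc; split.
- by exists 0; rewrite mul0r.
- by move=> _ _ [d ->] [e ->]; exists (d - e); rewrite mulrBl.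
- by move=> a _ [d ->]; exists (a * d); rewrite mulrA.
- by move=> [d] /esym; exact: nc.
Qed.

Hypothesis two_sided : forall L, maximal_left_ideal L ->
  forall a b, L a -> L (a * b).

(** If [c] has no left inverse, it generates a proper left ideal.  If
[d * c = 1] and [d] has no left inverse, then [d] lies in some maximal left
ideal, which being two-sided contains [d * c = 1].  If [d] has one too, it is
[c], and [c] is invertible. *)
Lemma noninvertible_in_maximal (c : A) : ~ invertible c ->
  exists2 L, maximal_left_ideal L & L c.
Proof.
move=> ninv.
have [[d dc]|nd] := pselect (exists d, d * c = 1); last first.
  have [|L maxL cL] := @exists_maximal_left_ideal [set x : A | exists d, x = d * c].
    by apply: principal_left_ideal => d dc; apply: nd; exists d.
  by exists L => //; apply: cL; exists 1; rewrite mul1r.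
have [[e ed]|ne] := pselect (exists e, e * d = 1).
  exfalso; apply: ninv; exists d; split => //.
  by rewrite -ed; congr (_ * _); rewrite -[e]mulr1 -dc mulrA ed mul1r.
have [|L maxL dL] := @exists_maximal_left_ideal [set x | exists e, x = e * d].
  by apply: principal_left_ideal => e ed; apply: ne; exists e.
have Ld : L d by apply: dL; exists 1; rewrite mul1r.
exfalso; apply: (lideal_proper maxL.1); rewrite -dc.
exact: two_sided.
Qed.

Lemma maximal_two_sided L : maximal_left_ideal L -> two_sided_ideal L.
Proof.
move=> maxL; have LP := maxL.1; split.
- exact: lideal0.
- exact: lidealB.
- exact: lidealM.
- exact: two_sided.
- exact: lideal_proper.
Qed.

End MaximalIdeals.

Section QuotientNorm.
Variables (R : realType) (A : algType R) (p : R) (nrm : A -> R).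
Hypotheses (p_gt0 : 0 < p) (nrmP : p_banach_norm p nrm).
Let nP := p_banach_seminorm nrmP.
Variables (I : set A) (maxI : maximal_left_ideal I) (idI : two_sided_ideal I).
Implicit Types (x y : quot idI).

Lemma quot_division x : x != 0 -> x \is a GRing.unit.
Proof.
have left_inv y : y != 0 -> exists z, z * y = 1.
  have [a ->] := projP y => a0.
  have Ia : ~ I a.
    move=> Ia; move/eqP: a0; apply; rewrite -(raddf0 (qproj idI)).
    by apply/proj_eq; rewrite subr0.
  have [d da] := maxI.2 a Ia; exists (qproj idI d).
  by rewrite -rmorphM -(rmorph1 (qproj idI)); exact/proj_eq.
move=> /left_inv[y yx].
have [|z zy] := left_inv y.
  by apply/eqP => y0; move: yx; rewrite y0 mul0r => /eqP; rewrite eq_sym oner_eq0.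
apply/unitrP; exists y; split => //.
by rewrite -zy; congr (_ * _); rewrite -[z]mulr1 -yx mulrA zy mul1r.
Qed.

Definition quot_norm x := inf [set nrm a | a in [set a | qproj idI a = x]].

Lemma quot_norm_lb x : has_lbound [set nrm a | a in [set a | qproj idI a = x]].
Proof. by exists 0 => _ [a _ <-]; exact: psn_ge0 nP _. Qed.

Lemma quot_norm_neq0 x : [set nrm a | a in [set a | qproj idI a = x]] !=set0.
Proof. by have [a ->] := projP x; exists (nrm a); exists a. Qed.

Lemma quot_norm_ge0 x : 0 <= quot_norm x.
Proof.
apply: lb_le_inf; first exact: quot_norm_neq0.
by move=> _ [a _ <-]; exact: psn_ge0 nP _.
Qed.

Lemma quot_norm_le a : quot_norm (qproj idI a) <= nrm a.
Proof. by apply: ge_inf; [exact: quot_norm_lb|exists a]. Qed.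

Lemma quot_norm_lt x e : quot_norm x < e -> exists2 a, qproj idI a = x & nrm a < e.
Proof.
by move=> /(inf_lt (quot_norm_neq0 x))[_ [a ax <-] lt_e]; exists a.
Qed.

Lemma quot_normP : p_seminorm p quot_norm.
Proof.
have normD x y : quot_norm (x + y) <= quot_norm x + quot_norm y.
  apply/ler_addgt0Pr => e e0.
  have e20 : 0 < e / 2 by rewrite divr_gt0.
  have /quot_norm_lt[a <- la] : quot_norm x < quot_norm x + e / 2 by rewrite ltrDl.
  have /quot_norm_lt[b <- lb] : quot_norm y < quot_norm y + e / 2 by rewrite ltrDl.
  rewrite -rmorphD (le_trans (quot_norm_le _))//.
  by rewrite (le_trans (psn_triangle nP _ _))//; lra.
have normM x y : quot_norm (x * y) <= quot_norm x * quot_norm y.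
  apply: ler_mul_gt => [||l k]; try exact: quot_norm_ge0.
  move=> /quot_norm_lt[a <- la] /quot_norm_lt[b <- lb].
  rewrite -rmorphM (le_trans (quot_norm_le _))//.
  by rewrite (le_trans (psn_submult nP _ _))// ler_pM ?(psn_ge0 nP)// ltW.
have normZ_le (t : R) x : quot_norm (t *: x) <= `|t| `^ p * quot_norm x.
  apply/ler_addgt0Pr => e e0.
  pose d := e / (`|t| `^ p + 1).
  have s0 : 0 < `|t| `^ p + 1 by rewrite ltr_wpDl// powR_ge0.
  have d0 : 0 < d by rewrite divr_gt0.
  have /quot_norm_lt[a <- la] : quot_norm x < quot_norm x + d by rewrite ltrDl.
  rewrite -linearZ (le_trans (quot_norm_le _))// (psn_homogeneous nP).
  have de : d * (`|t| `^ p + 1) = e by rewrite divfK// gt_eqF.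
  have : `|t| `^ p * nrm a <= `|t| `^ p * (quot_norm (qproj idI a) + d).
    by rewrite ler_wpM2l ?powR_ge0// ltW.
  lra.
split => //; first exact: quot_norm_ge0.
move=> t x; apply/eqP; rewrite eq_le normZ_le/=.
have [->|t0] := eqVneq t 0.
  by rewrite normr0 powR0 ?gt_eqF// mul0r quot_norm_ge0.
have nt0 : 0 < `|t| by rewrite normr_gt0.
have := normZ_le t^-1 (t *: x); rewrite scalerA mulVf// scale1r normfV.
rewrite -[_^-1]powR_inv1 ?normr_ge0// -powRrM mulN1r powRN mulrC.
by rewrite ler_pdivlMr ?powR_gt0// mulrC.
Qed.

(** If [nrm a < 1] then [1 - a] is invertible, so it is not in [I] and [a] is
not a representative of [1]. *)
Lemma quot_norm1_gt0 : 0 < quot_norm 1.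
Proof.
apply: (@lt_le_trans _ _ 1) => //; apply: lb_le_inf; first exact: quot_norm_neq0.
move=> _ [a a1 <-]; rewrite leNgt; apply/negP => /(neumann p_gt0 nrmP).
apply: (lideal_invertible maxI.1); rewrite -opprB; apply: (idealN idI).
by apply/proj_eq; rewrite a1 rmorph1.
Qed.

Lemma quot_quadratic x : exists s t : R, (x - s%:A) ^+ 2 + (t ^+ 2)%:A = 0.
Proof.
have [s [t st]] := gelfand_mazur p_gt0 quot_normP quot_norm1_gt0 x.
by exists s, t; apply/eqP; apply: contraNT st; exact: quot_division.
Qed.

Theorem maximal_ideal_qchar : exists x : qchar A, forall a, I a -> x a = 0.
Proof.
have [f [flin fM f1]] := frobenius_embedding quot_division quot_quadratic.
pose F := f \o qproj idI.
have Flin : linear F by move=> t a b; rewrite /F /= linearP flin.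
have FM : {morph F : a b / a * b >-> a * b} by move=> a b; rewrite /F /= rmorphM fM.
have F1 : F 1 = 1 by rewrite /F /= rmorph1 f1.
pose L := GRing.isLinear.Build R A (quat R) *:%R F Flin.
pose FL : {linear A -> quat R} := HB.pack F L.
have ne0 : exists a, FL a != 0 by exists 1; rewrite /= F1 oner_eq0.
exists (@QChar R A FL FM ne0) => a Ia /=.
rewrite /F /=; have -> : qproj idI a = 0.
  by rewrite -(raddf0 (qproj idI)); apply/proj_eq; rewrite subr0.
by have := flin (-1) 0 0; rewrite !scaleN1r !addNr.
Qed.

End QuotientNorm.

(** * The representation by quaternion-valued functions *)
Theorem theorem3p6 (R : realType) (A : algType R) (p : R) (nrm : A -> R) (m : R)
    (p_gt0 : 0 < p) (p_le1 : p <= 1)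
    (nrmP : p_banach_norm p nrm)
    (m_gt0 : 0 < m)
    (nrm_radius : forall a : A,
       ((nrm a `^ p^-1)%:E <= m%:E * spectral_radius a)%E) :
  [/\ linear (@J R A), GRing.monoid_morphism (@J R A), injective (@J R A),
      forall a : A,
        ((m^-1 * nrm a `^ p^-1)%:E <= supnorm (J a))%E /\
        (supnorm (J a) <= (nrm a `^ p^-1)%:E)%E
    & m = 1 -> forall a : A, (nrm a `^ p^-1)%:E = supnorm (J a)].
Proof.
have two_sided : forall L : set A, maximal_left_ideal L ->
    forall a b, L a -> L (a * b).
  move=> L maxL a b.
  exact: (maximal_left_ideal_two_sided p_gt0 nrmP m_gt0 nrm_radius maxL).
have supLB a : ((m^-1 * nrm a `^ p^-1)%:E <= supnorm (J a))%E.
  rewrite EFinM muleC lee_pdivrMr//= muleC (le_trans (nrm_radius a))//.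
  rewrite lee_pmul2l// ?lte_fin//.
  apply: ge_ereal_sup => _ [z az <-].
  have [L maxL Lz] := noninvertible_in_maximal two_sided az.
  have idL := maximal_two_sided two_sided maxL.
  have [x xL] := maximal_ideal_qchar p_gt0 nrmP maxL idL.
  apply: ereal_sup_ubound; exists x => //; congr EFin.
  rewrite complex_normE; apply: (congr1 Num.sqrt); apply: quat_sqnorm_root.
  by have := xL _ Lz; rewrite linearD qchar_scalar qcharX linearB qchar_scalar.
have supUB a : (supnorm (J a) <= (nrm a `^ p^-1)%:E)%E.
  apply: ge_ereal_sup => _ [x _ <-]; rewrite lee_fin.
  exact: (qchar_norm_le p_gt0 nrmP).
have Jlin : linear (@J R A).
  by move=> t a b; apply/continuousEP => x; exact: (linearP (qchar_fun x)).
split => //.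
- split; first by apply/continuousEP => x; exact: qchar1.
  by move=> a b; apply/continuousEP => x; exact: qcharM.
- move=> a b Jab; apply/eqP; rewrite -subr_eq0; apply/eqP.
  apply: (phn_definite (pbn_norm nrmP)).
  have J0 : (supnorm (J (a - b)) <= 0)%E.
    apply: ge_ereal_sup => _ [x _ <-]; rewrite lee_fin.
    rewrite -[J (a - b) x]/(qchar_fun x (a - b)) linearB.
    have -> : x a = x b by have /continuousEP/(_ x) := Jab.
    by rewrite subrr normr0.
  have := le_trans (supLB (a - b)) J0.
  rewrite lee_fin pmulr_rle0 ?invr_gt0// => le0.
  apply/eqP; have : nrm (a - b) `^ p^-1 == 0 by rewrite eq_le le0 powR_ge0.
  by rewrite powR_eq0 => /andP[].
move=> m1 a; apply/eqP; rewrite eq_le supUB andbT.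
by have := supLB a; rewrite m1 invr1 mul1r.
Qed.
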